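(* For any fixed odd positive integer $d$, the quasiconvexity of polynomials of degree $d$ can be checked in polynomial time; that is, there is an algorithm which, given a polynomial $p$ of degree $d$ in $n$ real variables ($n$ is part of the input) with rational coefficients, correctly decides whether $p$ is quasiconvex, in time polynomial in the number of bits of the input.
   Context: A function $f:\mathbb{R}^n\to\mathbb{R}$ is quasiconvex if all its sublevel sets $\{x\in\mathbb{R}^n: f(x)\le\alpha\}$, $\alpha\in\mathbb{R}$, are convex. An input polynomial is given by the ordered list of its (rational) coefficients, and input size is the number of bits of this list. *)

(* Defs.v *)
From HB Require Import structures.
From mathcomp Require Import all_boot all_order all_algebra.
From mathcomp.multinomials Require Import mpoly.
From mathcomp Require Import boolp classical_sets reals convex.

Set Implicit Arguments.
Unset Strict Implicit.
Unset Printing Implicit Defensive.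

Import Order.TTheory GRing.Theory Num.Theory.

Local Open Scope ring_scope.

Inductive direction := Left | Stay | Right.

(* A two-way infinite tape; [lefts] lists the cells to the left of the head
   starting from the nearest one, and the unlisted cells are blank. *)
Record tape (S : Type) := Tape { lefts : seq S; scanned : S; rights : seq S }.

Definition move_head (S : Type) (blank : S) (m : direction) (t : tape S) :
    tape S :=
  match m with
  | Left => Tape (behead (lefts t)) (head blank (lefts t))
                 (scanned t :: rights t)
  | Stay => t
  | Right => Tape (scanned t :: lefts t) (head blank (rights t))
                  (behead (rights t))
  end.

(* The tape symbols are the blank [None], the input bits [Some (inl b)] and the
   machine's own work symbols [Some (inr s)].  The transition function has a
   finite domain and codomain, so it is a finite table.  [verdict q] is [None]
   unless [q] is a halting state, accepting or rejecting. *)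
Record turing_machine := TuringMachine {
  extra_tapes : nat;
  work_symbol : finType;
  state : finType;
  start : state;
  verdict : state -> option bool;
  transition :
    state -> {ffun 'I_extra_tapes.+1 -> option (bool + work_symbol)} ->
    state * {ffun 'I_extra_tapes.+1 -> option (bool + work_symbol) * direction}
}.

Section Computation.
Variable M : turing_machine.

Definition symbol : Type := option (bool + work_symbol M).

Record configuration := Configuration {
  control : state M;
  tapes : {ffun 'I_(extra_tapes M).+1 -> tape symbol}
}.

Definition step (c : configuration) : configuration :=
  if verdict (control c) is Some _ then c else
  let: (q, act) := transition (control c) [ffun i => scanned (tapes c i)] in
  Configuration q
    [ffun i => move_head None (act i).2
                 (Tape (lefts (tapes c i)) (act i).1 (rights (tapes c i)))].

Definition input_tape (w : seq bool) : tape symbol :=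
  let s := [seq Some (inl b) | b <- w] in Tape [::] (head None s) (behead s).

Definition initial (w : seq bool) : configuration :=
  Configuration (start M)
    [ffun i => if i == ord0 then input_tape w else Tape [::] None [::]].

Definition answers_within (t : nat) (w : seq bool) (b : bool) : Prop :=
  verdict (control (iter t step (initial w))) = Some b.

End Computation.

(* The machine is only constrained on the words that encode an instance. *)
Definition polytime_decidable (I : Type) (enc : I -> seq bool) (P : I -> Prop) :
    Prop :=
  exists (M : turing_machine) (T : {poly nat}), forall x : I,
    exists b : bool,
      answers_within M T.[size (enc x)] (enc x) b /\ (b <-> P x).

(* Binary digits, least significant first; 0 is written with one digit. *)
Definition bits (n : nat) : seq bool :=
  mkseq (fun i => odd (n %/ 2 ^ i)) (trunc_log 2 n).+1.

(* Self-delimiting form of [bits n]: every digit is preceded by the mark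
   [true], and the mark [false] ends the number. *)
Definition encode_nat (n : nat) : seq bool :=
  flatten [seq [:: true; b] | b <- bits n] ++ [:: false].

Definition encode_rat (q : rat) : seq bool :=
  (q < 0) :: encode_nat `|numq q|%N ++ encode_nat `|denq q|%N.

(* The library's order on monomials is graded lexicographic. *)
Definition monomials (n d : nat) : seq 'X_{1..n} :=
  sort <=%O [seq bmnm m | m : 'X_{1..n < d.+1}].

Record ratpoly (d : nat) := RatPoly {
  nvars : nat;
  poly_of : {mpoly rat[nvars]};
  _ : msize poly_of = d.+1
}.

(* The ordered list of all (zero or nonzero) coefficients.  The number of
   variables n is not written: for d > 0 it is determined by the length
   'C(n + d, d) of the list. *)
Definition encode_ratpoly (d : nat) (p : ratpoly d) : seq bool :=
  flatten [seq encode_rat (poly_of p)@_m | m <- monomials (nvars p) d].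

Definition real_function (R : realType) (d : nat) (p : ratpoly d) :
    'rV[R]_(nvars p) -> R :=
  fun x => (map_mpoly ratr (poly_of p)).@[fun i => x 0 i].

Definition quasiconvex (R : realType) (n : nat) (f : 'rV[R]_n -> R) : Prop :=
  forall alpha : R, @convex_set R 'rV[R]_n [set x | f x <= alpha]%classic.

(* Main.v *)
Require Import Defs.
From mathcomp Require Import all_boot all_order all_algebra.
From mathcomp Require Import reals.
From mathcomp Require Import zify ring.
From mathcomp Require Import polyorder polyrcf qe_rcf_th.
From mathcomp.multinomials Require Import mpoly.
From mathcomp Require Import boolp classical_sets unstable interval_inference.

Set Implicit Arguments.
Unset Strict Implicit.
Unset Printing Implicit Defensive.

(** Why quasiconvexity is easy to test in odd degree. Let [f] have odd degree
    [d]. Along a direction [v] in which the leading form is positive, [f] is a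
    univariate polynomial of odd degree with positive leading coefficient; if
    it is quasiconvex it cannot decrease anywhere, for it tends to minus
    infinity on the left. So at every point the derivative of a quasiconvex
    [f] along [v] is zero or has the sign of the leading form at [v], for [v]
    in a dense set; hence the derivatives along any [v] at any two points never have
    opposite signs ([slopes_same_sign]). Two gradients for which no [v]
    separates the signs are parallel ([gradients_parallel]), and each partial
    derivative keeps a weak sign on the whole space. Conversely, if all
    gradients are multiples of one covector [xi], each partial derivative is a
    univariate polynomial composed with the linear form [xi]
    ([proportional_gradient]); if that polynomial keeps its sign, [f] is
    monotone along every line and so quasiconvex. This gives the criterion
    [quasiconvex_criterion]: the matrix with one row for each variable, made
    of the coefficients of the partial derivatives, has rank at most one, and
    each partial derivative keeps its sign on its own coordinate axis.

    Both conditions are tested with rational arithmetic. The first consists of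
    polynomially many two by two minors. The second concerns univariate
    polynomials of degree less than [d]: a nonzero [g] is nonnegative if and
    only if its leading coefficient is positive, its degree is even and it has
    no negative value at a critical point ([negative_critical_point]), and
    the last property is an equality of two Cauchy indices ([nonnegativeP]).
    These come out of a signed Euclidean algorithm ([cindexR_modp]), which
    takes a bounded number of divisions since [d] is fixed: all intermediate
    numbers keep polynomial size ([polytime_nonnegative]).

    To speak of Turing machines, data are coded as binary trees. A function is
    called [polytime] when a program acting on four stacks replaces the code of
    the argument by the code of the value in polynomial time. This class is
    closed under composition, pairing, branching and folds whose accumulator
    stays polynomially bounded ([polytime_foldl]), so the algorithm is written
    as an ordinary function and analysed by the shape of its text. Programs are
    compiled to machines with one tape for each stack ([represents_exec],
    [decider_answers]), whence [polytime_decides].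

    The input is a bare list of coefficients in graded lexicographic order. The
    number of variables is recovered by listing the monomials in one more
    variable at a time until there are as many as coefficients ([monomialsE],
    [enumerateE]). *)

(** * Stack programs and their compilation to Turing machines *)

(** The mark delimits work areas on the stacks; inputs consist of bits. *)
Definition letter := (bool + unit)%type.
Definition bit (b : bool) : letter := inl b.
Definition mark : letter := inr tt.

Inductive stack := SA | SB | SC | SK.

Record store := Store {
  stackA : seq letter; stackB : seq letter;
  stackC : seq letter; stackK : seq letter
}.

Definition get (s : store) (r : stack) : seq letter :=
  match r with
  | SA => stackA s | SB => stackB s | SC => stackC s | SK => stackK s
  end.

Definition update (s : store) (r : stack) (v : seq letter) : store :=
  match r with
  | SA => Store v (stackB s) (stackC s) (stackK s)
  | SB => Store (stackA s) v (stackC s) (stackK s)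
  | SC => Store (stackA s) (stackB s) v (stackK s)
  | SK => Store (stackA s) (stackB s) (stackC s) v
  end.

(** A program sees the tops of its stacks and nothing else, so each stack can
    live on a tape of its own. [Until] loops as long as the top differs from
    the given letter, [None] standing for the empty stack. *)
Inductive prog :=
  | Skip
  | Push of stack & letter
  | Pop of stack
  | Seq of prog & prog
  | If of stack & option letter & prog & prog
  | Until of stack & option letter & prog.

(** The cost counts the steps of the compiled program exactly: one for a
    test, a jump or a move of the head. A push takes two, as the head must
    first reach the cell that is to be written. *)
Inductive exec : prog -> store -> store -> nat -> Prop :=
  | ESkip s : exec Skip s s 0
  | EPush r x s : exec (Push r x) s (update s r (x :: get s r)) 2
  | EPop r s : exec (Pop r) s (update s r (behead (get s r))) 1
  | ESeq p q s1 s2 s3 t1 t2 :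
      exec p s1 s2 t1 -> exec q s2 s3 t2 -> exec (Seq p q) s1 s3 (t1 + t2)
  | EIfT r a p q s s' t :
      ohead (get s r) = a -> exec p s s' t -> exec (If r a p q) s s' t.+1
  | EIfF r a p q s s' t :
      ohead (get s r) <> a -> exec q s s' t -> exec (If r a p q) s s' t.+2
  | EStop r a p s : ohead (get s r) = a -> exec (Until r a p) s s 1
  | ELoop r a p s s' s'' t t' :
      ohead (get s r) <> a -> exec p s s' t -> exec (Until r a p) s' s'' t' ->
      exec (Until r a p) s s'' (t + t').+2.

Inductive instr :=
  | Act of stack & option (option letter) & direction
  | Test of stack & option letter & nat
  | Jump of nat
  | Halt of bool.

Fixpoint code_size (p : prog) : nat :=
  match p with
  | Skip => 0
  | Push _ _ => 2
  | Pop _ => 1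
  | Seq p q => code_size p + code_size q
  | If _ _ p q => (code_size p + code_size q).+2
  | Until _ _ p => (code_size p).+2
  end.

Fixpoint compile (p : prog) (o : nat) : seq instr :=
  match p with
  | Skip => [::]
  | Push r x => [:: Act r None Left; Act r (Some (Some x)) Stay]
  | Pop r => [:: Act r None Right]
  | Seq p q => compile p o ++ compile q (o + code_size p)
  | If r a p q =>
      let o' := (o + code_size q).+2 in
      Test r a o' :: compile q o.+1
        ++ Jump (o' + code_size p) :: compile p o'
  | Until r a p =>
      Test r a (o + code_size p).+2 :: compile p o.+1 ++ [:: Jump o]
  end.

Lemma size_compile p o : size (compile p o) = code_size p.
Proof.
elim: p o => //= [p IHp q IHq|r a p IHp q IHq|r a p IHp] o.
- by rewrite size_cat IHp IHq.
- by rewrite size_cat /= IHp IHq addnS addnC.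
- by rewrite size_cat /= IHp addn1.
Qed.

Definition tape_index (r : stack) : 'I_4 :=
  match r with
  | SA => inord 0 | SB => inord 1 | SC => inord 2 | SK => inord 3
  end.

Lemma tape_index_inj : injective tape_index.
Proof.
by move=> r r' /(congr1 val); case: r; case: r' => //=; rewrite !inordK.
Qed.

Section Machine.
Variable code : seq instr.

Definition instr_at (q : nat) : instr := nth (Halt false) code q.

Definition machine_transition (q : 'I_(size code).+1)
    (s : {ffun 'I_4 -> option letter}) :
    'I_(size code).+1 * {ffun 'I_4 -> option letter * direction} :=
  match instr_at q with
  | Act r w m =>
      (inord q.+1,
       [ffun i => if i == tape_index r then (odflt (s i) w, m)
                  else (s i, Stay)])
  | Test r a q' =>
      (inord (if s (tape_index r) == a then q' else q.+1),
       [ffun i => (s i, Stay)])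
  | Jump q' => (inord q', [ffun i => (s i, Stay)])
  | Halt _ => (q, [ffun i => (s i, Stay)])
  end.

Definition machine : turing_machine :=
  @TuringMachine 3 unit 'I_(size code).+1 ord0
    (fun q => if instr_at q is Halt b then Some b else None)
    machine_transition.

(** A stack occupies its tape from the head rightwards; the cells to the left
    of the head are arbitrary, since pushing overwrites them. *)
Definition holds (t : tape (option letter)) (s : seq letter) : Prop :=
  forall i, nth None (scanned t :: rights t) i = nth None (map Some s) i.

Definition represents (c : configuration machine) (q : nat) (s : store) :
    Prop :=
  (control c : 'I_(size code).+1) = q :> nat
  /\ forall r, holds (tapes c (tape_index r)) (get s r).

Lemma holds_scanned t s : holds t s -> scanned t = ohead s.
Proof. by move/(_ 0); case: s. Qed.

Lemma holds_pop t s : holds t s ->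
  holds (move_head None Right t) (behead s).
Proof.
move=> h i; rewrite /move_head /=.
transitivity (nth None (map Some s) i.+1); last first.
  by case: s {h} => [|x s] //=; case: i.
rewrite -h /=; case: (rights t) => [|x l]; case: i => //= i; by rewrite nth_nil.
Qed.

Lemma holds_push t s x : holds t s ->
  let t' := move_head None Left t in
  holds (Tape (lefts t') (Some x) (rights t')) (x :: s).
Proof. by move=> h t' [|i] //; apply: h. Qed.

Lemma eta_tape (t : tape (option letter)) :
  Tape (lefts t) (scanned t) (rights t) = t.
Proof. by case: t. Qed.

Lemma get_update s r v r' :
  get (update s r v) r' =
  if tape_index r' == tape_index r then v else get s r'.
Proof.
case: eqP => [/tape_index_inj ->|]; first by case: r.
by case: r; case: r' => // -[].
Qed.

Lemma step_act (c : configuration machine) q r w m :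
  (control c : 'I_(size code).+1) = q :> nat ->
  instr_at q = Act r w m -> q < size code ->
  (control (step c) : 'I_(size code).+1) = q.+1 :> nat /\
  forall i, tapes (step c) i =
    if i == tape_index r then
      move_head None m
        (Tape (lefts (tapes c i)) (odflt (scanned (tapes c i)) w)
              (rights (tapes c i)))
    else tapes c i.
Proof.
move=> hq hi ltq; rewrite /step /= hq hi.
rewrite /machine_transition hq hi; split; first by rewrite /= inordK.
by move=> i; rewrite !ffunE; case: eqP => //= _; rewrite eta_tape.
Qed.

Lemma represents_test c q s r a q' :
  represents c q s -> instr_at q = Test r a q' -> q < size code ->
  q' <= size code ->
  represents (step c) (if ohead (get s r) == a then q' else q.+1) s.
Proof.
move=> [hq hs] hi ltq leq'; rewrite /step /= hq hi.
rewrite /machine_transition hq hi; split.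
  by rewrite /= ffunE (holds_scanned (hs r)) inordK //; case: ifP.
by move=> r'; rewrite !ffunE /= eta_tape; apply: hs.
Qed.

Lemma represents_jump c q s q' :
  represents c q s -> instr_at q = Jump q' -> q' <= size code ->
  represents (step c) q' s.
Proof.
move=> [hq hs] hi leq'; rewrite /step /= hq hi.
rewrite /machine_transition hq hi; split; first by rewrite /= inordK.
by move=> r'; rewrite !ffunE /= eta_tape; apply: hs.
Qed.

Definition code_at (l : seq instr) (o : nat) : Prop :=
  o + size l <= size code /\
  forall i, i < size l -> instr_at (o + i) = nth (Halt false) l i.

Lemma code_at_cat l1 l2 o :
  code_at (l1 ++ l2) o -> code_at l1 o /\ code_at l2 (o + size l1).
Proof.
case; rewrite size_cat => le_o h; split; split.
- by apply: leq_trans le_o; rewrite leq_add2l leq_addr.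
- by move=> i lti; rewrite h ?nth_cat ?lti // ltn_addr.
- by rewrite -addnA.
- by move=> i lti; rewrite -addnA h ?ltn_add2l // nth_cat ltnNge leq_addr addKn.
Qed.

Lemma code_at_cons x l o :
  code_at (x :: l) o -> [/\ instr_at o = x, o < size code & code_at l o.+1].
Proof.
rewrite -cat1s => /code_at_cat[[lto h] h']; rewrite /= addn1 in lto h'.
by split=> //; have := h 0 isT; rewrite addn0.
Qed.

(** Induction on the execution; the code of a subprogram may sit at any offset
    of the code of the machine. *)
Lemma represents_exec p s s' t : exec p s s' t ->
  forall o, code_at (compile p o) o -> forall c, represents c o s ->
  represents (iter t (@step machine) c) (o + code_size p) s'.
Proof.
elim=> {p s s' t}.
- by move=> s o _ c; rewrite addn0.
- move=> r x s o /= /code_at_cons[i0 lt0 /code_at_cons[i1 lt1 _]] c [hq hs].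
  have [hq1 ht1] := step_act hq i0 lt0; have [hq2 ht2] := step_act hq1 i1 lt1.
  split=> [|r']; first by rewrite hq2 addn2.
  rewrite /= ht2 ht1 get_update; case: eqP => [->|_]; last exact: hs.
  by rewrite eta_tape; apply: holds_push.
- move=> r s o /= /code_at_cons[i0 lt0 _] c [hq hs].
  have [hq1 ht1] := step_act hq i0 lt0.
  split=> [|r']; first by rewrite hq1 addn1.
  rewrite /= ht1 get_update; case: eqP => [->|_]; last exact: hs.
  by rewrite eta_tape; apply: holds_pop.
- move=> p q s1 s2 s3 t1 t2 _ IHp _ IHq o /= /code_at_cat[hp hq] c rep.
  rewrite size_compile in hq.
  by rewrite addnC iterD addnA; apply: IHq => //; apply: IHp.
- move=> r a p q s s' t top _ IHp o /= /code_at_cons[i0 lt0].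
  case/code_at_cat=> _; rewrite size_compile => /code_at_cons[_ _ hp] c rep.
  have le' : (o + code_size q).+2 <= size code.
    by case: hp => le1 _; apply: leq_trans le1; rewrite addSn leq_addr.
  have := represents_test rep i0 lt0 le'; rewrite top eqxx => rep1.
  rewrite -iterS iterSr; have := IHp _ _ _ rep1; rewrite addSn in hp.
  by move/(_ hp); rewrite !addSn -addnA (addnC (code_size q)) !addnS.
- move=> r a p q s s' t top _ IHq o /= /code_at_cons[i0 lt0].
  case/code_at_cat=> hq; rewrite size_compile => /code_at_cons[ij ltj hp] c rep.
  have le' : (o + code_size q).+2 <= size code by rewrite -addSn.
  have := represents_test rep i0 lt0 le'; case: eqP => // _ rep1.
  have rep2 := IHq _ hq _ rep1.
  rewrite -iterS iterSr; have := represents_jump rep2 ij.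
  rewrite !addSn !addnS addnAC addnA; apply.
  by case: hp => le1 _; apply: leq_trans le1; rewrite size_compile !addSn addnAC.
- move=> r a p s top o /= /code_at_cons[i0 lt0 /code_at_cat[_]].
  rewrite size_compile => /code_at_cons[ij ltj _] c rep.
  have le' : (o + code_size p).+2 <= size code by rewrite -addSn.
  have := represents_test rep i0 lt0 le'; rewrite top eqxx.
  by rewrite !addnS.
- move=> r a p s s' s'' t t' top _ IHp _ IHw o hw c rep.
  move: (hw) => /= /code_at_cons[i0 lt0 /code_at_cat[hp]].
  rewrite size_compile => /code_at_cons[ij ltj _].
  have le' : (o + code_size p).+2 <= size code by rewrite -addSn.
  have := represents_test rep i0 lt0 le'; case: eqP => // _ rep1.
  have rep2 := represents_jump (IHp _ hp _ rep1) ij (ltnW lt0).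
  have := IHw _ hw _ rep2; rewrite -iterS -iterSr -iterD.
  by rewrite addnS addnC addSn.
Qed.
End Machine.

Lemma answers_within_le (M : turing_machine) t t' w b :
  t <= t' -> answers_within M t w b -> answers_within M t' w b.
Proof.
move=> /subnK <-; rewrite /answers_within; elim: (t' - t) => [//|k IH] ht.
by rewrite addSn /= {1}/step IH //= IH.
Qed.

Definition decider (p : prog) : seq instr :=
  compile p 0 ++
  [:: Test SA (Some (bit true)) (code_size p).+2; Halt false; Halt true].

Lemma decider_answers p w s' t :
  exec p (Store (map bit w) [::] [::] [::]) s' t ->
  answers_within (machine (decider p)) t.+1 w
    (ohead (stackA s') == Some (bit true)).
Proof.
move=> ex; set M := machine _.
have sz : size (decider p) = (code_size p + 3).
  by rewrite size_cat size_compile.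
have at0 : code_at (decider p) (decider p) 0 by split=> // i.
have [hp] := code_at_cat at0.
rewrite size_compile /= => /code_at_cons[it ltt].
case/code_at_cons=> [if0 _ /code_at_cons[if1 _ _]].
have rep0 : represents (initial M w) 0 (Store (map bit w) [::] [::] [::]).
  split=> //; case=> i; rewrite ffunE.
  - have -> : (tape_index SA == ord0) by rewrite -val_eqE /= inordK.
    by rewrite /input_tape; case: w {ex} => [|b w] /=; case: i => //= i;
       rewrite ?nth_nil // -map_comp.
  - have -> : (tape_index SB == ord0) = false by rewrite -val_eqE /= inordK.
    by case: i => [|i] //=; rewrite nth_nil.
  - have -> : (tape_index SC == ord0) = false by rewrite -val_eqE /= inordK.
    by case: i => [|i] //=; rewrite nth_nil.
  - have -> : (tape_index SK == ord0) = false by rewrite -val_eqE /= inordK.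
    by case: i => [|i] //=; rewrite nth_nil.
have rep1 := represents_exec ex hp rep0.
have [|hq _] := represents_test rep1 it ltt _.
  by rewrite sz addn3.
rewrite /answers_within iterS /= hq.
by case: ifP => _; rewrite ?if0 ?if1 //=.
Qed.

(** * Polynomial bounds *)

(** Natural coefficients make these bounds monotone. *)
Definition is_poly (g : nat -> nat) : Prop :=
  exists T : {poly nat}, forall n, g n = T.[n]%R.

Section PolynomialBounds.
Import GRing.Theory.

Lemma is_poly_const c : is_poly (fun=> c).
Proof. by exists (c%:P)%R => n; rewrite hornerC. Qed.

Lemma is_poly_id : is_poly id.
Proof. by exists 'X%R => n; rewrite hornerX. Qed.

Lemma is_poly_add f g : is_poly f -> is_poly g -> is_poly (fun n => f n + g n).
Proof. by move=> [T hT] [U hU]; exists (T + U)%R => n; rewrite hornerD hT hU. Qed.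

Lemma is_poly_mul f g : is_poly f -> is_poly g -> is_poly (fun n => f n * g n).
Proof. by move=> [T hT] [U hU]; exists (T * U)%R => n; rewrite hornerM hT hU. Qed.

Lemma is_poly_comp f g : is_poly f -> is_poly g -> is_poly (fun n => f (g n)).
Proof.
by move=> [T hT] [U hU]; exists (T \Po U)%R => n; rewrite horner_comp -hU -hT.
Qed.

Lemma is_poly_exp f k : is_poly f -> is_poly (fun n => f n ^ k).
Proof.
move=> pf; elim: k => [|k [T hT]]; first exact: is_poly_const.
have [U hU] := is_poly_mul pf (ex_intro (fun T => _) T hT).
by exists U => n; rewrite -hU expnS.
Qed.

Lemma is_poly_mono g m n : is_poly g -> m <= n -> g m <= g n.
Proof.
move=> [T hT] le_mn; rewrite !hT !horner_coef.
elim/big_ind2: _ => // [a b c d le1 le2|i _]; first exact: leq_add.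
by apply: leq_mul => //; elim: (val i) => // j IH; rewrite !exprS leq_mul.
Qed.

End PolynomialBounds.

Ltac poly_bound :=
  repeat first
    [ assumption | exact: is_poly_const | exact: is_poly_id
    | apply: is_poly_add | apply: is_poly_mul | apply: is_poly_exp
    | match goal with
      | H : is_poly ?g |- is_poly (fun n => ?g _) => apply: (is_poly_comp H)
      end ].

(** * Programs on coded trees *)

(** Time bounds, as opposed to exact costs, compose without equations on the
    times. *)
Definition runs (p : prog) (s s' : store) (t : nat) : Prop :=
  exists2 t', t' <= t & exec p s s' t'.

Lemma runs_le p s s' t t' : runs p s s' t -> t <= t' -> runs p s s' t'.
Proof. by move=> [u le_u ex] le_t; exists u => //; apply: leq_trans le_t. Qed.

Lemma runs_skip s t : runs Skip s s t.
Proof. by exists 0 => //; constructor. Qed.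

Lemma runs_push r x s s' t :
  update s r (x :: get s r) = s' -> 2 <= t -> runs (Push r x) s s' t.
Proof. by move=> <- le_t; exists 2 => //; constructor. Qed.

Lemma runs_pop r s s' t :
  update s r (behead (get s r)) = s' -> 1 <= t -> runs (Pop r) s s' t.
Proof. by move=> <- le_t; exists 1 => //; constructor. Qed.

Lemma runs_seq p q s1 s2 s3 t1 t2 :
  runs p s1 s2 t1 -> runs q s2 s3 t2 -> runs (Seq p q) s1 s3 (t1 + t2).
Proof.
move=> [u1 le1 ex1] [u2 le2 ex2]; exists (u1 + u2); first exact: leq_add.
exact: ESeq ex1 ex2.
Qed.

Lemma runs_if r a p q s s' t :
  (if ohead (get s r) == a then runs p s s' t else runs q s s' t) ->
  runs (If r a p q) s s' t.+2.
Proof.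
case: eqP => top [u le_u ex]; first by exists u.+1; [exact: leqW | exact: EIfT].
by exists u.+2 => //; apply: EIfF.
Qed.

Lemma runs_stop r a p s t :
  ohead (get s r) = a -> 1 <= t -> runs (Until r a p) s s t.
Proof. by move=> top le_t; exists 1 => //; apply: EStop. Qed.

Lemma runs_loop r a p s s' s'' t t' :
  ohead (get s r) <> a -> runs p s s' t -> runs (Until r a p) s' s'' t' ->
  runs (Until r a p) s s'' (t + t').+2.
Proof.
move=> top [u le_u ex] [u' le_u' ex']; exists (u + u').+2.
  by rewrite !ltnS leq_add.
exact: ELoop ex ex'.
Qed.

Infix ";;" := Seq (at level 61, right associativity).

Inductive tree := Leaf | Node of tree & tree.

(** A prefix code: the end of a tree can be recognized whatever follows it. *)
Fixpoint code (x : tree) : seq bool :=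
  if x is Node l r then true :: code l ++ code r else [:: false].

Definition word (x : tree) : seq letter := map bit (code x).

Lemma word_Node l r : word (Node l r) = bit true :: word l ++ word r.
Proof. by rewrite /word /= map_cat. Qed.

(** The stack of pending subtrees is kept in unary above a mark: a node
    replaces one pending subtree by two, a leaf removes one. *)
Definition take_value (r : stack) : prog :=
  Push SK mark;; Push SK (bit true);;
  Until SK (Some mark)
    (Pop SK;;
     If r (Some (bit true))
       (Pop r;; Push SC (bit true);; Push SK (bit true);; Push SK (bit true))
       (Pop r;; Push SC (bit false)));;
  Pop SK.

Definition data (inA : bool) : stack := if inA then SA else SB.

Definition data_store (inA : bool) (v w c k : seq letter) : store :=
  if inA then Store v w c k else Store w v c k.

Ltac run_push := by apply: runs_push; [reflexivity | exact: leqnn].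
Ltac run_pop := by apply: runs_pop; [reflexivity | exact: leqnn].

(** Stated in continuation form, as the loop reads through the subtrees of a
    tree without stopping between them. *)
Lemma runs_take_loop i x : forall a b c k s t,
  let loop := Until SK (Some mark)
    (Pop SK;;
     If (data i) (Some (bit true))
       (Pop (data i);; Push SC (bit true);; Push SK (bit true);;
        Push SK (bit true))
       (Pop (data i);; Push SC (bit false))) in
  runs loop (data_store i a b (catrev (word x) c) k) s t ->
  runs loop (data_store i (word x ++ a) b c (bit true :: k)) s
    (t + 12 * size (code x)).
Proof.
elim: x => [|x IHx y IHy] a b c k s t loop run.
  apply: runs_le.
    apply: (runs_loop (s' := data_store i a b (bit false :: c) k));
      [by case: i {run loop} | | exact: run].
    apply: (runs_seq (s2 := data_store i (bit false :: a) b c k)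
        (t1 := 1) (t2 := 5)).
      by case: i {run loop}; run_pop.
    by apply: runs_if; case: i {run loop};
       (apply: (@runs_seq _ _ _ _ _ 1 2); [run_pop|run_push]).
  by rewrite /=; lia.
rewrite word_Node in run *.
apply: runs_le.
  apply: (runs_loop (s' := data_store i (word x ++ word y ++ a) b
                             (bit true :: c) (bit true :: bit true :: k))).
  - by case: i {IHx IHy run loop}.
  - apply: (runs_seq (s2 := data_store i
        (bit true :: (word x ++ word y) ++ a) b c k)
        (t1 := 1) (t2 := 9)).
      by case: i {IHx IHy run loop}; run_pop.
    apply: runs_if; case: i {IHx IHy run loop} => /=;
    (apply: (@runs_seq _ _ _ _ _ 1 6); [run_pop|]);
    (apply: (@runs_seq _ _ _ _ _ 2 4); [run_push|]);
    (apply: (@runs_seq _ _ _ _ _ 2 2); [run_push|]);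
    by apply: runs_push; [rewrite /= -catA | exact: leqnn].
  - apply: IHx; apply: IHy.
    by move: run; rewrite /= catrev_catl; apply.
by rewrite /= size_cat; lia.
Qed.

Lemma runs_take_value i x a b c k :
  runs (take_value (data i)) (data_store i (word x ++ a) b c k)
    (data_store i a b (catrev (word x) c) k) (12 * size (code x) + 6).
Proof.
apply: runs_le.
  apply: (runs_seq (s2 := data_store i (word x ++ a) b c (mark :: k)) (t1 := 2)).
    by case: i; run_push.
  apply: (runs_seq
    (s2 := data_store i (word x ++ a) b c (bit true :: mark :: k))
    (t1 := 2)).
    by case: i; run_push.
  apply: (runs_seq
    (s2 := data_store i a b (catrev (word x) c) (mark :: k))
    (t2 := 1)).
    apply: runs_take_loop; instantiate (1 := 1).
    by apply: runs_stop => //; case: i.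
  by case: i; run_pop.
by rewrite /=; lia.
Qed.

(** Emptying the third stack down to the mark restores the order of the
    letters, on the first stack, on the second, on both or on none. *)
Definition drain (toA toB : bool) : prog :=
  let put b := (if toA then Push SA (bit b) else Skip);;
               (if toB then Push SB (bit b) else Skip) in
  Until SC (Some mark)
    (If SC (Some (bit true)) (Pop SC;; put true) (Pop SC;; put false));;
  Pop SC.

Lemma runs_drain toA toB v a b c k :
  runs (drain toA toB) (Store a b (map bit v ++ mark :: c) k)
    (Store (if toA then catrev (map bit v) a else a)
           (if toB then catrev (map bit v) b else b) c k)
    (10 * size v + 4).
Proof.
apply: runs_le.
  apply: (runs_seq (t1 := 10 * size v + 1) (t2 := 1)
    (s2 := Store (if toA then catrev (map bit v) a else a)
       (if toB then catrev (map bit v) b else b) (mark :: c) k));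
    last by run_pop.
  elim: v a b => [|x v IH] a b.
    by case: toA; case: toB; apply: runs_stop.
  apply: runs_le.
    apply: (runs_loop (t := 7) (s' := Store (if toA then bit x :: a else a)
        (if toB then bit x :: b else b) (map bit v ++ mark :: c) k));
      first by case: x.
      apply: (runs_if (t := 5)).
      case: x; case: toA {IH}; case: toB => /=;
      (apply: (@runs_seq _ _ _ _ _ 1 4); [run_pop|]);
      (apply: (@runs_seq _ _ _ _ _ 2 2));
      first [run_push | exact: runs_skip].
    have := IH (if toA then bit x :: a else a) (if toB then bit x :: b else b).
    by case: toA {IH}; case: toB => /= IH; exact: IH.
  by rewrite /=; lia.
by lia.
Qed.

Lemma runs_take_drain i toA toB x a b c k :
  runs (Push SC mark;; take_value (data i);; drain toA toB)
    (data_store i (word x ++ a) b c k)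
    (if i then Store (if toA then word x ++ a else a)
                     (if toB then word x ++ b else b) c k
     else Store (if toA then word x ++ b else b)
                (if toB then word x ++ a else a) c k)
    (22 * size (code x) + 12).
Proof.
have rwx s : catrev (catrev (word x) [::]) s = word x ++ s.
  by rewrite -[catrev (word x) _]/(rev (word x)) catrevE revK.
have -> : 22 * size (code x) + 12 =
  2 + ((12 * size (code x) + 6) + (10 * size (rev (code x)) + 4)).
  by rewrite size_rev; lia.
apply: (runs_seq (s2 := data_store i (word x ++ a) b (mark :: c) k)).
  by case: i; run_push.
apply: runs_seq; first exact: runs_take_value.
have -> : catrev (word x) (mark :: c) = map bit (rev (code x)) ++ mark :: c.
  by rewrite catrevE map_rev.
have := runs_drain toA toB (rev (code x))
  (if i then a else b) (if i then b else a) c k.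
by rewrite map_rev /rev !rwx; case: i.
Qed.

Definition dup := Push SC mark;; take_value SA;; drain true true.
Definition move_to_B := Push SC mark;; take_value SA;; drain false true.
Definition move_to_A := Push SC mark;; take_value SB;; drain true false.
Definition drop_value := Push SC mark;; take_value SA;; drain false false.

Section Moves.
Variables (x : tree) (a b c k : seq letter).
Let t := 22 * size (code x) + 12.

Lemma runs_dup :
  runs dup (Store (word x ++ a) b c k) (Store (word x ++ a) (word x ++ b) c k) t.
Proof. exact: (runs_take_drain true true true). Qed.

Lemma runs_move_to_B :
  runs move_to_B (Store (word x ++ a) b c k) (Store a (word x ++ b) c k) t.
Proof. exact: (runs_take_drain true false true). Qed.

Lemma runs_move_to_A :
  runs move_to_A (Store a (word x ++ b) c k) (Store (word x ++ a) b c k) t.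
Proof. exact: (runs_take_drain false true false). Qed.

Lemma runs_drop : runs drop_value (Store (word x ++ a) b c k) (Store a b c k) t.
Proof. exact: (runs_take_drain true false false). Qed.

End Moves.

Fixpoint push_bits (v : seq bool) : prog :=
  if v is x :: v' then push_bits v';; Push SA (bit x) else Skip.

Lemma runs_push_bits v a b c k :
  runs (push_bits v) (Store a b c k) (Store (map bit v ++ a) b c k)
    (2 * size v).
Proof.
elim: v => [|x v IH]; first exact: runs_skip.
apply: runs_le; first by apply: runs_seq; [exact: IH | run_push].
by rewrite /=; lia.
Qed.

(** Popping the letter of the root leaves the two subtrees side by side. *)
Definition left_value := Pop SA;; move_to_B;; drop_value;; move_to_A.
Definition right_value := Pop SA;; drop_value.

Lemma runs_left x y a b c k :
  runs left_value (Store (word (Node x y) ++ a) b c k)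
    (Store (word x ++ a) b c k) (44 * size (code x) + 22 * size (code y) + 40).
Proof.
apply: runs_le.
  rewrite word_Node /= -catA.
  apply: runs_seq; first by run_pop.
  apply: runs_seq; first exact: runs_move_to_B.
  apply: runs_seq; first exact: runs_drop.
  exact: runs_move_to_A.
by lia.
Qed.

Lemma runs_right x y a b c k :
  runs right_value (Store (word (Node x y) ++ a) b c k)
    (Store (word y ++ a) b c k) (22 * size (code x) + 20).
Proof.
apply: runs_le.
  rewrite word_Node /= -catA.
  apply: runs_seq; [by run_pop | exact: runs_drop].
by lia.
Qed.

(** * Polynomial-time functions between encoded types *)

(** Any map to trees will do, injective or not. *)
Class encoding (A : Type) := encode : A -> tree.

Definition bits_of {A} {eA : encoding A} (x : A) : nat := size (code (encode x)).

(** The program replaces the value on top of the first stack and leaves the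
    rest of the store as it found it, so programs compose freely. *)
Definition computes {A B} {eA : encoding A} {eB : encoding B} (f : A -> B)
    (p : prog) (g : nat -> nat) : Prop :=
  forall x, bits_of (f x) <= g (bits_of x) /\
    forall a b c k, runs p (Store (word (encode x) ++ a) b c k)
      (Store (word (encode (f x)) ++ a) b c k) (g (bits_of x)).

Definition polytime {A B} {eA : encoding A} {eB : encoding B} (f : A -> B) :
    Prop :=
  exists p g, is_poly g /\ computes f p g.

#[export] Instance encoding_unit : encoding unit := fun=> Leaf.
#[export] Instance encoding_bool : encoding bool :=
  fun b => if b then Node Leaf Leaf else Leaf.
#[export] Instance encoding_nat : encoding nat := fun n => iter n (Node Leaf) Leaf.
#[export] Instance encoding_prod A B (eA : encoding A) (eB : encoding B) :
  encoding (A * B) := fun x => Node (encode x.1) (encode x.2).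
#[export] Instance encoding_seq A (eA : encoding A) : encoding (seq A) :=
  foldr (fun x t => Node (encode x) t) Leaf.

Lemma bits_of_gt0 A (eA : encoding A) (x : A) : 0 < bits_of x.
Proof. by rewrite /bits_of; case: (encode x). Qed.

Lemma bits_of_pair A B (eA : encoding A) (eB : encoding B) (x : A) (y : B) :
  bits_of (x, y) = (bits_of x + bits_of y).+1.
Proof. by rewrite /bits_of /= size_cat. Qed.

Lemma word_pair A B (eA : encoding A) (eB : encoding B) (x : A) (y : B) :
  word (encode (x, y)) = bit true :: word (encode x) ++ word (encode y).
Proof. exact: word_Node. Qed.

Lemma bits_of_cons A (eA : encoding A) (x : A) (s : seq A) :
  bits_of (x :: s) = (bits_of x + bits_of s).+1.
Proof. by rewrite /bits_of /= size_cat. Qed.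

Lemma bits_of_nil A (eA : encoding A) : bits_of (@nil A) = 1.
Proof. by []. Qed.

Lemma bits_of_bool (b : bool) : bits_of b <= 3.
Proof. by case: b. Qed.

Lemma bits_of_nat n : bits_of n = n.*2.+1.
Proof. by elim: n => //= n IH; rewrite doubleS -IH /bits_of /=. Qed.

Section Closure.
Context {A B C E : Type}.
Context {eA : encoding A} {eB : encoding B} {eC : encoding C} {eE : encoding E}.

Lemma polytime_ext (f f' : A -> B) : f =1 f' -> polytime f -> polytime f'.
Proof.
move=> eqf [p [g [pg cf]]]; exists p, g; split=> // x.
by rewrite -eqf; apply: cf.
Qed.

(** The empty program computes such a function: only the type changes. *)
Lemma polytime_recode (f : A -> B) :
  (forall x, encode (f x) = encode x) -> polytime f.
Proof.
move=> ef; exists Skip, id; split; first exact: is_poly_id.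
by move=> x; rewrite /bits_of ef; split=> // *; apply: runs_skip.
Qed.

Lemma polytime_id : polytime (fun x : A => x).
Proof.
exists Skip, id; split; first exact: is_poly_id.
by move=> x; split=> // *; apply: runs_skip.
Qed.

Lemma polytime_comp (f : A -> B) (g : B -> C) :
  polytime f -> polytime g -> polytime (fun x => g (f x)).
Proof.
move=> [p [u [pu cf]]] [q [v [pv cg]]].
exists (p;; q), (fun n => u n + v (u n)); split; first by poly_bound.
move=> x; have [szf rf] := cf x; have [szg rg] := cg (f x).
have le_v := is_poly_mono pv szf; split; first by lia.
by move=> *; apply: (runs_le (runs_seq (rf _ _ _ _) (rg _ _ _ _))); lia.
Qed.

Lemma polytime_const (y : B) : polytime (fun _ : A => y).
Proof.
exists (drop_value;; push_bits (code (encode y))).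
exists (fun n => 22 * n + 12 + 2 * bits_of y); split; first by poly_bound.
move=> x; split; first by lia.
move=> *.
apply: (runs_le (runs_seq (runs_drop _ _ _ _ _) (runs_push_bits _ _ _ _ _))).
by unfold bits_of in *; lia.
Qed.

(** The argument is duplicated, and one copy waits on the second stack. *)
Lemma polytime_pair (f : E -> A) (g : E -> B) :
  polytime f -> polytime g -> polytime (fun e => (f e, g e)).
Proof.
move=> [p [u [pu cf]]] [q [v [pv cg]]].
exists (dup;; q;; move_to_A;; p;; Push SA (bit true)).
exists (fun n => 50 * n + 50 + u n + v n); split; first by poly_bound.
move=> x; have [szf rf] := cf x; have [szg rg] := cg x.
split; first by rewrite bits_of_pair; lia.
move=> a b c k; apply: runs_le.
  apply: runs_seq; first exact: runs_dup.
  apply: runs_seq; first exact: rg.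
  apply: runs_seq; first exact: runs_move_to_A.
  apply: runs_seq; first exact: rf.
  apply: runs_push; last exact: leqnn.
  by rewrite word_pair /= -catA.
by unfold bits_of in *; lia.
Qed.

Lemma polytime_fst : polytime (fun x : A * B => x.1).
Proof.
exists left_value, (fun n => 66 * n + 66); split; first by poly_bound.
move=> [x y]; rewrite bits_of_pair; split; first by rewrite /=; lia.
by move=> *; apply: (runs_le (runs_left _ _ _ _ _ _)); rewrite /bits_of /=; lia.
Qed.

Lemma polytime_snd : polytime (fun x : A * B => x.2).
Proof.
exists right_value, (fun n => 66 * n + 66); split; first by poly_bound.
move=> [x y]; rewrite bits_of_pair; split; first by rewrite /=; lia.
by move=> *; apply: (runs_le (runs_right _ _ _ _ _ _)); rewrite /bits_of /=; lia.
Qed.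

Lemma polytime_head (d : A) : polytime (head d).
Proof.
exists (If SA (Some (bit true)) left_value
  (drop_value;; push_bits (code (encode d)))).
exists (fun n => 66 * n + 100 + 2 * bits_of d); split; first by poly_bound.
move=> [|x s].
  rewrite bits_of_nil; split; first by rewrite /=; lia.
  move=> *; apply: runs_le; first apply: runs_if => /=.
    apply: runs_seq; [exact: (runs_drop Leaf) | exact: runs_push_bits].
  by rewrite -/(bits_of d) /=; lia.
rewrite bits_of_cons; split; first by rewrite /=; lia.
move=> a b c k; pose proof (run := runs_left (encode x) (encode s) a b c k).
apply: runs_le; first by apply: runs_if => /=; exact: run.
rewrite -/(bits_of x) -/(bits_of s). lia.
Qed.

Lemma polytime_behead : polytime (@behead A).
Proof.
exists (If SA (Some (bit true)) right_value Skip).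
exists (fun n => 66 * n + 66); split; first by poly_bound.
move=> [|x s].
  split; first by rewrite /=; lia.
  move=> *; apply: runs_le; last exact: leqnn.
  by rewrite addnS addnS; apply: runs_if => /=; exact: runs_skip.
rewrite bits_of_cons; split; first by rewrite /=; lia.
move=> a b c k; pose proof (run := runs_right (encode x) (encode s) a b c k).
apply: runs_le; first by apply: runs_if => /=; exact: run.
by rewrite -/(bits_of x); lia.
Qed.

Lemma polytime_nilp : polytime (@nilp A).
Proof.
exists (If SA (Some (bit true)) (drop_value;; push_bits (code (encode false)))
  (drop_value;; push_bits (code (encode true)))).
exists (fun n => 66 * n + 66); split; first by poly_bound.
move=> s; split; first by have := bits_of_bool (nilp s); lia.
move=> *; apply: (@runs_le _ _ _ (22 * bits_of s + 12 + 2 * 3).+2);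
  last by lia.
apply: runs_if; case: s => [|x s] /=.
  apply: runs_seq; first exact: (runs_drop Leaf).
  exact: (runs_push_bits (code (Node Leaf Leaf))).
apply: runs_seq; first exact: (runs_drop (encode (x :: s))).
by apply: (runs_le (runs_push_bits (code Leaf) _ _ _ _)).
Qed.

Lemma polytime_if (t : E -> bool) (f g : E -> A) :
  polytime t -> polytime f -> polytime g ->
  polytime (fun e => if t e then f e else g e).
Proof.
move=> [r [w [pw ct]]] [p [u [pu cf]]] [q [v [pv cg]]].
exists (dup;; r;; If SA (Some (bit true))
  (drop_value;; move_to_A;; p) (drop_value;; move_to_A;; q)).
exists (fun n => 50 * n + 200 + u n + v n + w n); split; first by poly_bound.
move=> x; have [szf rf] := cf x; have [szg rg] := cg x.
have [szt rt] := ct x; split; first by case: ifP; lia.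
move=> a b c k; apply: runs_le.
  apply: runs_seq; first exact: runs_dup.
  apply: runs_seq; first exact: rt.
  apply: (@runs_if _ _ _ _ _ _ (100 + 22 * bits_of x + u (bits_of x)
     + v (bits_of x))).
  case: (t x) => /=.
    apply: runs_le.
      apply: runs_seq; first exact: (runs_drop (encode true)).
      apply: runs_seq; [exact: runs_move_to_A | exact: rf].
    by have := bits_of_bool true; unfold bits_of in *; lia.
  apply: runs_le.
    apply: runs_seq; first exact: (runs_drop (encode false)).
    apply: runs_seq; [exact: runs_move_to_A | exact: rg].
  by have := bits_of_bool false; unfold bits_of in *; lia.
by unfold bits_of in *; lia.
Qed.

End Closure.

Lemma polytime_negb : polytime negb.
Proof.
apply: (polytime_ext (f := fun b : bool => if b then false else true)).
  by case.
apply: polytime_if; [exact: polytime_id | exact: polytime_const..].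
Qed.

Section Iteration.
Context {E S : Type} {eE : encoding E} {eS : encoding S}.

(** A loop whose number of rounds and whose intermediate states are
    polynomially bounded. *)
Lemma polytime_iter (init : E -> S) (step : S -> S) (go : S -> bool)
    (count : E -> nat) (N Q : nat -> nat) :
  polytime init -> polytime step -> polytime go -> is_poly N -> is_poly Q ->
  (forall e, count e <= N (bits_of e)) ->
  (forall e i, i <= count e -> go (iter i step (init e)) = (i < count e)) ->
  (forall e i, i <= count e -> bits_of (iter i step (init e)) <= Q (bits_of e)) ->
  polytime (fun e => iter (count e) step (init e)).
Proof.
move=> [pi [u [pu ci]]] [ps [v [pv cs]]] [pg [w [pw cg]]] pN pQ hN hgo hQ.
pose loop := Until SA (Some (bit false))
  (drop_value;; move_to_A;; ps;; dup;; pg).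
exists (pi;; dup;; pg;; loop;; drop_value;; move_to_A).
pose K n := 66 * Q n + v (Q n) + w (Q n) + 300.
exists (fun n => u n + (N n + 3) * K n); split; first by rewrite /K; poly_bound.
move=> e; set n := bits_of e.
have [szi ri] := ci e; have le_n := hN e; rewrite -/n in le_n.
pose s i := iter i step (init e).
have le_s i : i <= count e -> bits_of (s i) <= Q n by exact: hQ.
have le_v i : i <= count e -> v (bits_of (s i)) <= v (Q n).
  by move=> ?; apply: is_poly_mono => //; exact: hQ.
have le_w i : i <= count e -> w (bits_of (s i)) <= w (Q n).
  by move=> ?; apply: is_poly_mono => //; exact: hQ.
split; first by have := le_s _ (leqnn _); rewrite mulnDl {2}/K /s; lia.
move=> a b c k.
have run_loop m i : i + m = count e ->
  runs loop (Store (word (encode (go (s i))) ++ a) (word (encode (s i)) ++ b) c k)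
    (Store (word (encode false) ++ a) (word (encode (s (count e))) ++ b) c k)
    (m * K n + 1).
  elim: m i => [|m IH] i.
    rewrite addn0 => ->; rewrite /s hgo // ltnn.
    by apply: runs_stop.
  move=> im; have lt_i : i < count e by lia.
  have [szs rs] := cs (s i); have [szg rg] := cg (s i.+1).
  apply: runs_le.
    apply: runs_loop; first by rewrite /s hgo ?lt_i // ltnW.
      apply: runs_seq; first exact: runs_drop.
      apply: runs_seq; first exact: runs_move_to_A.
      apply: runs_seq; first exact: rs.
      apply: runs_seq; first exact: runs_dup.
      exact: rg.
    by apply: IH; lia.
  have := le_s _ (ltnW lt_i); have := le_s _ lt_i.
  have := le_v _ (ltnW lt_i); have := le_w _ lt_i.
  have := bits_of_bool (go (s i)).
  unfold bits_of in *; rewrite -/(iter i.+1 step (init e)) -/(s i.+1) in szs *.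
  by rewrite /K mulSn; lia.
have [szg rg] := cg (s 0).
apply: runs_le.
  apply: runs_seq; first exact: ri.
  apply: runs_seq; first exact: runs_dup.
  apply: runs_seq; first exact: rg.
  apply: runs_seq; first exact: (run_loop (count e) 0).
  apply: runs_seq; first exact: runs_drop.
  exact: runs_move_to_A.
have := le_s 0 (leq0n _); have := le_s _ (leqnn _); have := le_w 0 (leq0n _).
have : count e * K n <= N n * K n by rewrite leq_mul.
have : 3 * K n = 3 * (66 * Q n + v (Q n) + w (Q n) + 300) by [].
by rewrite mulnDl /s /=; unfold n, bits_of; lia.
Qed.

End Iteration.

Section Folds.
Context {E S A : Type} {eE : encoding E} {eS : encoding S} {eA : encoding A}.

Lemma bits_of_drop (l : seq A) i : bits_of (drop i l) <= bits_of l.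
Proof.
elim: l i => [|x l IH] [|i] //=; apply: leq_trans (IH i) _.
by rewrite bits_of_cons; lia.
Qed.

Lemma size_bits_of (l : seq A) : size l < bits_of l.
Proof. by elim: l => //= x l IH; rewrite bits_of_cons; lia. Qed.

(** The state of the loop consists of the parameter, the accumulator and the
    rest of the list. *)
Lemma polytime_foldl (x0 : A) (f : E -> S -> A -> S) (init : E -> S)
    (l : E -> seq A) (Q : nat -> nat) :
  polytime (fun x : E * S * A => f x.1.1 x.1.2 x.2) ->
  polytime init -> polytime l -> is_poly Q ->
  (forall e i, i <= size (l e) ->
     bits_of (foldl (f e) (init e) (take i (l e))) <= Q (bits_of e)) ->
  polytime (fun e => foldl (f e) (init e) (l e)).
Proof.
move=> pf pinit pl pQ hQ; have [pr [w [pw cl]]] := pl.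
pose start e := (e, init e, l e).
pose step (x : E * S * seq A) :=
  (x.1.1, f x.1.1 x.1.2 (head x0 x.2), behead x.2).
have iterE e i : i <= size (l e) -> iter i step (start e) =
    (e, foldl (f e) (init e) (take i (l e)), drop i (l e)).
  elim: i => [|i IH] le_i; first by rewrite /= take0 drop0.
  rewrite iterS (IH (ltnW le_i)) /step /= -drop1 drop_drop add1n -nth0.
  by rewrite nth_drop addn0 (take_nth x0 le_i) foldl_rcons.
pose last_state e := iter (size (l e)) step (start e).
have : polytime last_state.
  apply: (@polytime_iter _ _ _ _ start step (fun x => ~~ nilp x.2)
    (fun e => size (l e)) w (fun n => n + Q n + w n + 2)).
  - by apply: polytime_pair => //; apply: polytime_pair => //; apply: polytime_id.
  - pose proof (pS := polytime_fst (A := E * S) (B := seq A)).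
    pose proof (pE := polytime_comp pS (polytime_fst (A := E) (B := S))).
    pose proof (pl2 := polytime_snd (A := E * S) (B := seq A)).
    apply: polytime_pair; last exact: polytime_comp pl2 polytime_behead.
    apply: polytime_pair => //.
    refine (polytime_comp (f := fun x : E * S * seq A =>
      (x.1.1, x.1.2, head x0 x.2)) _ pf).
    apply: polytime_pair; last exact: polytime_comp pl2 (polytime_head x0).
    by apply: polytime_pair => //; exact: polytime_comp pS polytime_snd.
  - exact: polytime_comp (polytime_comp polytime_snd polytime_nilp) polytime_negb.
  - by [].
  - by poly_bound.
  - by move=> e; have [] := cl e; have := size_bits_of (l e); lia.
  - move=> e i le_i; rewrite iterE //= /nilp size_drop subn_eq0.
    by rewrite -ltnNge.
  - move=> e i le_i; rewrite iterE // !bits_of_pair.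
    have := hQ e i le_i; have := bits_of_drop (l e) i; have [] := cl e; lia.
move=> plast; apply: (polytime_ext (f := fun e => (last_state e).1.2)).
  by move=> e; rewrite /last_state iterE //= take_size.
exact: polytime_comp (polytime_comp plast polytime_fst) polytime_snd.
Qed.

End Folds.

(** * From polynomial-time functions to Turing machines *)

Definition reverse_input : prog :=
  Until SA None
    (If SA (Some (bit true)) (Pop SA;; Push SC (bit true))
                             (Pop SA;; Push SC (bit false))).

(** The reversed input is scanned from the last bit on, growing the code of a
    list from its end: consing a bit onto a list prefixes its code by the
    letter of a node and the code of the bit. *)
Definition encode_input : prog :=
  Until SC None
    (If SC (Some (bit true))
      (Pop SC;; push_bits (true :: code (encode true)))
      (Pop SC;; push_bits (true :: code (encode false)))).

Definition read_input : prog :=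
  reverse_input;; Push SA (bit false);; encode_input.

Lemma runs_reverse_input w b c k :
  runs reverse_input (Store (map bit w) b c k)
    (Store [::] b (catrev (map bit w) c) k) (7 * size w + 1).
Proof.
elim: w c => [|x w IH] c; first exact: runs_stop.
apply: runs_le.
  apply: runs_loop; [by [] | | exact: IH].
  apply: (runs_if (t := 3)).
  by case: x => /=; (apply: (@runs_seq _ _ _ _ _ 1 2); [run_pop|run_push]).
by rewrite /=; lia.
Qed.

Lemma runs_encode_input u v b k :
  runs encode_input (Store (word (encode v)) b (map bit u) k)
    (Store (word (encode (catrev u v))) b [::] k) (20 * size u + 1).
Proof.
elim: u v => [|x u IH] v; first exact: runs_stop.
apply: runs_le.
  apply: (runs_loop (t := 12)
    (s' := Store (word (encode (x :: v))) b (map bit u) k));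
    [by [] | | exact: IH].
  apply: (runs_if (t := 10)); case: x => /=.
    apply: runs_le; first apply: runs_seq; first by run_pop.
      exact: (runs_push_bits (true :: code (encode true))).
    by [].
  apply: runs_le; first apply: runs_seq; first by run_pop.
    exact: (runs_push_bits (true :: code (encode false))).
  by [].
by rewrite /=; lia.
Qed.

Lemma bits_of_bits (w : seq bool) : bits_of w <= 4 * size w + 1.
Proof.
by elim: w => // x w IH; rewrite bits_of_cons /=; have := bits_of_bool x; lia.
Qed.

Lemma runs_read_input w :
  runs read_input (Store (map bit w) [::] [::] [::])
    (Store (word (encode w)) [::] [::] [::]) (30 * size w + 10).
Proof.
apply: runs_le.
  apply: runs_seq; first exact: runs_reverse_input.
  apply: runs_seq; first by run_push.
  have := runs_encode_input (rev w) [::] [::] [::].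
  by rewrite map_rev -[catrev (rev w) [::]]/(rev (rev w)) revK; apply.
by rewrite size_rev; lia.
Qed.

(** The program first turns the raw bits of the input into the code of a list
    of booleans, whose length is linear in that of the input. *)
Theorem polytime_decides (I : Type) (enc : I -> seq bool) (P : I -> Prop)
    (f : seq bool -> bool) :
  polytime f -> (forall x, f (enc x) <-> P x) -> polytime_decidable enc P.
Proof.
move=> [p [g [pg cf]]] hf; exists (machine (decider (read_input;; p))).
have [T hT] : is_poly (fun n => 30 * n + 10 + g (4 * n + 1) + 1) by poly_bound.
exists T => x; exists (f (enc x)); split; last exact: hf.
have [_ /(_ [::] [::] [::] [::])] := cf (enc x); rewrite cats0 => rp.
have [t le_t ex] := runs_seq (runs_read_input (enc x)) rp.
apply: answers_within_le (_ : t.+1 <= _) _.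
  rewrite -hT; have := is_poly_mono pg (bits_of_bits (enc x)); lia.
by have := decider_answers ex; rewrite /=; case: (f (enc x)).
Qed.

(** * Polynomial-time list and number functions *)

(** Proof search follows the syntax of a function; opacity keeps the
    closure lemmas from matching up to unfolding. *)
Create HintDb polytime discriminated.
#[export] Hint Constants Opaque : polytime.
#[export] Hint Projections Opaque : polytime.
Ltac polytime := cbv beta; typeclasses eauto with polytime nocore.

#[export] Hint Resolve polytime_id polytime_const polytime_pair polytime_if
  polytime_fst polytime_snd polytime_head polytime_behead polytime_nilp
  : polytime.

Section Basic.
Context {E A B C : Type}.
Context {eE : encoding E} {eA : encoding A} {eB : encoding B} {eC : encoding C}.

Lemma polytime_fst_of (f : E -> A * B) :
  polytime f -> polytime (fun e => (f e).1).
Proof. move=> pf; exact: polytime_comp pf polytime_fst. Qed.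

Lemma polytime_snd_of (f : E -> A * B) :
  polytime f -> polytime (fun e => (f e).2).
Proof. move=> pf; exact: polytime_comp pf polytime_snd. Qed.

Lemma polytime_cons (f : E -> A) (g : E -> seq A) :
  polytime f -> polytime g -> polytime (fun e => f e :: g e).
Proof.
move=> pf pg; refine (polytime_comp (polytime_pair pf pg)
  (polytime_recode (f := fun x => x.1 :: x.2) _)).
by case.
Qed.

Lemma polytime_head_of d (f : E -> seq A) :
  polytime f -> polytime (fun e => head d (f e)).
Proof. move=> pf; exact: polytime_comp pf (polytime_head d). Qed.

Lemma polytime_behead_of (f : E -> seq A) :
  polytime f -> polytime (fun e => behead (f e)).
Proof. move=> pf; exact: polytime_comp pf polytime_behead. Qed.

Lemma polytime_nilp_of (f : E -> seq A) :
  polytime f -> polytime (fun e => nilp (f e)).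
Proof. move=> pf; exact: polytime_comp pf polytime_nilp. Qed.

Lemma polytime_neg (f : E -> bool) :
  polytime f -> polytime (fun e => ~~ f e).
Proof. move=> pf; exact: polytime_comp pf polytime_negb. Qed.

Lemma polytime_and (f g : E -> bool) :
  polytime f -> polytime g -> polytime (fun e => f e && g e).
Proof.
move=> pf pg; apply: (polytime_ext (f := fun e => if f e then g e else false)).
  by [].
by polytime.
Qed.

Lemma polytime_or (f g : E -> bool) :
  polytime f -> polytime g -> polytime (fun e => f e || g e).
Proof.
move=> pf pg; apply: (polytime_ext (f := fun e => if f e then true else g e)).
  by [].
by polytime.
Qed.

Lemma polytime_eqb (f g : E -> bool) :
  polytime f -> polytime g -> polytime (fun e => f e == g e).
Proof.
move=> pf pg; apply: (polytime_ext (f := fun e => if f e then g e else ~~ g e)).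
  by move=> e; case: (f e); case: (g e).
by apply: polytime_if => //; apply: polytime_neg.
Qed.

End Basic.

#[export] Hint Resolve polytime_fst_of polytime_snd_of polytime_cons
  polytime_head_of polytime_behead_of polytime_nilp_of polytime_neg
  polytime_and polytime_or polytime_eqb : polytime.

Section Folds.
Context {E S A B : Type}.
Context {eE : encoding E} {eS : encoding S} {eA : encoding A} {eB : encoding B}.

(** It suffices that each step adds to the state an amount that does not
    depend on the state. *)
Lemma polytime_foldl_grow (x0 : A) (f : E -> S -> A -> S) (init : E -> S)
    (l : E -> seq A) (G : nat -> nat) :
  polytime (fun x : E * S * A => f x.1.1 x.1.2 x.2) ->
  polytime init -> polytime l -> is_poly G ->
  (forall e s x, bits_of (f e s x) <= bits_of s + G (bits_of e + bits_of x)) ->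
  polytime (fun e => foldl (f e) (init e) (l e)).
Proof.
move=> pf pinit pl pG hG; have [pr0 [u [pu ci]]] := pinit.
have [pr [w [pw cl]]] := pl.
apply: (polytime_foldl x0 (Q := fun n => u n + w n * G (n + w n)) pf pinit pl).
  by poly_bound.
move=> e i le_i; have [szi _] := ci e; have [szl _] := cl e.
have h : bits_of (foldl (f e) (init e) (take i (l e))) <=
    bits_of (init e) + i * G (bits_of e + w (bits_of e)); last first.
  apply: leq_trans h _; rewrite leq_add // leq_mul2r; apply/orP; right.
  exact: leq_trans le_i (leq_trans (ltnW (size_bits_of _)) szl).
elim: i le_i => [|i IH] le_i; first by rewrite take0 addn0.
rewrite (take_nth x0 le_i) foldl_rcons.
apply: leq_trans (hG _ _ _) _; have := IH (ltnW le_i).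
have : G (bits_of e + bits_of (nth x0 (l e) i)) <=
       G (bits_of e + w (bits_of e)); last by lia.
apply: is_poly_mono => //; rewrite leq_add2l; apply: leq_trans szl.
apply: leq_trans (bits_of_drop _ i); rewrite (drop_nth x0 le_i) bits_of_cons.
by lia.
Qed.

End Folds.

Section Lists.
Context {E A : Type} {eE : encoding E} {eA : encoding A}.

(** Most list functions below are folds that build their value in reverse,
    since an accumulator can be extended only in front. *)
Lemma polytime_catrev (f g : E -> seq A) (x0 : A) :
  polytime f -> polytime g -> polytime (fun e => catrev (f e) (g e)).
Proof.
move=> pf pg; apply: (polytime_ext
  (f := fun e => foldl (fun s x => x :: s) (g e) (f e))).
  by move=> e; elim: (f e) (g e) => //= x s IH t; rewrite IH.
apply: (polytime_foldl_grow (f := fun (e : E) (s : seq A) (x : A) => x :: s) x0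
  (G := fun n => n + 1)) => //.
- by polytime.
- by poly_bound.
- by move=> e s x; rewrite bits_of_cons; lia.
Qed.

Lemma polytime_rev (x0 : A) (f : E -> seq A) :
  polytime f -> polytime (fun e => rev (f e)).
Proof. by move=> pf; apply: (polytime_catrev x0) => //; apply: polytime_const. Qed.

Lemma polytime_cat (x0 : A) (f g : E -> seq A) :
  polytime f -> polytime g -> polytime (fun e => f e ++ g e).
Proof.
move=> pf pg; apply: (polytime_ext (f := fun e => catrev (rev (f e)) (g e))).
  by move=> e; rewrite catrevE revK.
by apply: (polytime_catrev x0) => //; apply: (polytime_rev x0).
Qed.

End Lists.

Section Comprehensions.
Context {E A B : Type} {eE : encoding E} {eA : encoding A} {eB : encoding B}.

Lemma polytime_map (x0 : A) (y0 : B) (f : E -> A -> B) (l : E -> seq A) :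
  polytime (fun x : E * A => f x.1 x.2) -> polytime l ->
  polytime (fun e => map (f e) (l e)).
Proof.
move=> pf pl; have [pr [g [pg cf]]] := pf.
apply: (polytime_ext
  (f := fun e => rev (foldl (fun s x => f e x :: s) [::] (l e)))).
  move=> e; rewrite -[LHS]cats0; move: (l e) => s.
  suff -> t : rev (foldl (fun s x => f e x :: s) t s) = rev t ++ map (f e) s.
    by rewrite cats0.
  elim: s t => [|x s IH] t /=; first by rewrite cats0.
  by rewrite IH rev_cons cat_rcons.
apply: (polytime_rev y0).
apply: (polytime_foldl_grow (f := fun (e : E) (s : seq B) (x : A) => f e x :: s) x0
  (G := fun n => g (n + 1) + 1)) => //.
- apply: polytime_cons; last by polytime.
  refine (polytime_comp (f := fun x : E * seq B * A => (x.1.1, x.2)) _ pf).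
  by polytime.
- by polytime.
- by poly_bound.
- move=> e s x; rewrite bits_of_cons; have [] := cf (e, x).
  by rewrite bits_of_pair /= !addn1; lia.
Qed.

Lemma polytime_all (x0 : A) (f : E -> A -> bool) (l : E -> seq A) :
  polytime (fun x : E * A => f x.1 x.2) -> polytime l ->
  polytime (fun e => all (f e) (l e)).
Proof.
move=> pf pl; apply: (polytime_ext
  (f := fun e => foldl (fun b x => b && f e x) true (l e))).
  move=> e; rewrite -[RHS]andTb; move: true => b.
  by elim: (l e) b => [|x s IH] b /=; rewrite ?andbT // IH andbA.
apply: (polytime_foldl_grow (f := fun (e : E) (b : bool) (x : A) => b && f e x) x0
  (G := fun n => 3)) => //.
- apply: polytime_and; first by polytime.
  refine (polytime_comp (f := fun x : E * bool * A => (x.1.1, x.2)) _ pf).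
  by polytime.
- by polytime.
- by poly_bound.
- by move=> e b x; apply: leq_trans (bits_of_bool _) _; lia.
Qed.

Lemma polytime_filter (x0 : A) (f : E -> A -> bool) (l : E -> seq A) :
  polytime (fun x : E * A => f x.1 x.2) -> polytime l ->
  polytime (fun e => filter (f e) (l e)).
Proof.
move=> pf pl; apply: (polytime_ext
  (f := fun e => rev (foldl (fun s x => if f e x then x :: s else s) [::] (l e)))).
  move=> e; rewrite -[RHS]cat0s -[[::] in RHS]/(rev [::] : seq A).
  move: (l e) [::] => s.
  elim: s => [|x s IH] t /=; first by rewrite cats0.
  by rewrite IH; case: ifP; rewrite ?rev_cons ?cat_rcons.
apply: (polytime_rev x0).
apply: (polytime_foldl_grow (f := fun (e : E) (s : seq A) (x : A) =>
  if f e x then x :: s else s) x0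
  (G := fun n => n + 1)) => //.
- apply: polytime_if; [|by polytime..].
  refine (polytime_comp (f := fun x : E * seq A * A => (x.1.1, x.2)) _ pf).
  by polytime.
- by polytime.
- by poly_bound.
- by move=> e s x; case: ifP; rewrite ?bits_of_cons; lia.
Qed.

Lemma polytime_zip (x0 : A) (y0 : B) (f : E -> seq A) (g : E -> seq B) :
  polytime f -> polytime g -> polytime (fun e => zip (f e) (g e)).
Proof.
move=> pf pg; pose step (s : seq B * seq (A * B)) x :=
  if nilp s.1 then s else (behead s.1, (x, head y0 s.1) :: s.2).
apply: (polytime_ext
  (f := fun e => rev (foldl step (g e, [::]) (f e)).2)).
  move=> e; rewrite -[RHS]cat0s -[[::] in RHS]/(rev [::] : seq (A * B)).
  move: (f e) (g e) [::] => s.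
  elim: s => [|x s IH] t r.
    by case: t => [|y t]; rewrite /= cats0.
  case: t => [|y t]; last by rewrite [LHS]/= IH rev_cons cat_rcons.
  by rewrite [LHS]/= {1}/step /= IH; case: s {IH}.
apply: (polytime_rev (x0, y0)); apply: polytime_snd_of.
apply: (polytime_foldl_grow (f := fun _ : E => step) x0
  (G := fun n => n + 2 + bits_of y0)) => //.
- by polytime.
- by polytime.
- by poly_bound.
- move=> e [[|y t] r] x; rewrite /step /=; first by rewrite leq_addr.
  by rewrite !bits_of_pair !bits_of_cons bits_of_pair; lia.
Qed.

End Comprehensions.

Section Successor.
Context {E : Type} {eE : encoding E}.
Implicit Types f g : E -> nat.

(** The unit paired in front of a numeral is its additional node. *)
Lemma polytime_succ f : polytime f -> polytime (fun e => (f e).+1).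
Proof.
move=> pf; refine (polytime_comp (f := fun e => (tt, f e)) _
  (polytime_recode (f := fun x => x.2.+1) _)); last by case=> [[] n].
by polytime.
Qed.

Lemma polytime_nseq f : polytime f -> polytime (fun e => nseq (f e) tt).
Proof.
move=> pf; refine (polytime_comp pf (polytime_recode (f := fun n => nseq n tt) _)).
by elim=> // n IH; exact: (congr1 (Node Leaf) IH).
Qed.

End Successor.

#[export] Hint Resolve polytime_succ polytime_nseq : polytime.

Section Size.
Context {E A : Type} {eE : encoding E} {eA : encoding A}.

Lemma polytime_size (x0 : A) (l : E -> seq A) :
  polytime l -> polytime (fun e => size (l e)).
Proof.
move=> pl; apply: (polytime_ext
  (f := fun e => foldl (fun n _ => n.+1) 0 (l e))).
  move=> e; rewrite -[RHS]add0n; move: 0 => n.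
  by elim: (l e) n => [|x s IH] n /=; rewrite ?addn0 // IH addnS.
apply: (polytime_foldl_grow (f := fun (_ : E) n (_ : A) => n.+1) x0
  (G := fun=> 2)) => //.
- by polytime.
- by polytime.
- by poly_bound.
- by move=> e n x; rewrite !bits_of_nat doubleS; lia.
Qed.

End Size.

Section Naturals.
Context {E A : Type} {eE : encoding E} {eA : encoding A}.
Implicit Types f g : E -> nat.

Lemma polytime_pred f : polytime f -> polytime (fun e => (f e).-1).
Proof.
move=> pf; apply: (polytime_ext (f := fun e => size (behead (nseq (f e) tt)))).
  by move=> e; rewrite size_behead size_nseq.
by apply: (polytime_size tt); apply: polytime_behead_of; apply: polytime_nseq.
Qed.

Lemma polytime_eq0 f : polytime f -> polytime (fun e => f e == 0).
Proof.
move=> pf; apply: (polytime_ext (f := fun e => nilp (nseq (f e) tt))).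
  by move=> e; rewrite /nilp size_nseq.
by apply: polytime_nilp_of; apply: polytime_nseq.
Qed.

Lemma polytime_odd f : polytime f -> polytime (fun e => odd (f e)).
Proof.
move=> pf; apply: (polytime_ext
  (f := fun e => foldl (fun b _ => ~~ b) false (nseq (f e) tt))).
  move=> e; rewrite -[odd _]addFb; move: false.
  elim: (f e) => [|n IH] b /=; first by rewrite addbF.
  by rewrite IH addbN addNb.
apply: (polytime_foldl_grow (f := fun (_ : E) (b : bool) (_ : unit) => ~~ b) tt
  (G := fun=> 3)) => //.
- by polytime.
- by polytime.
- by polytime.
- by poly_bound.
- by move=> e b x; apply: leq_trans (bits_of_bool _) _; rewrite leq_addl.
Qed.

Lemma polytime_drop f (l : E -> seq A) :
  polytime f -> polytime l -> polytime (fun e => drop (f e) (l e)).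
Proof.
move=> pf pl; apply: (polytime_ext
  (f := fun e => foldl (fun s _ => behead s) (l e) (nseq (f e) tt))).
  move=> e; elim: (f e) (l e) => [|n IH] s /=; first by rewrite drop0.
  by rewrite IH -drop1 drop_drop addn1.
apply: (polytime_foldl_grow (f := fun (_ : E) (s : seq A) (_ : unit) => behead s) tt
  (G := fun=> 0)) => //.
- by polytime.
- exact: polytime_nseq.
- by poly_bound.
- by move=> e [|x s] _; rewrite ?bits_of_cons ?addn0 //=; lia.
Qed.

Lemma polytime_nth d f (l : E -> seq A) :
  polytime f -> polytime l -> polytime (fun e => nth d (l e) (f e)).
Proof.
move=> pf pl; apply: (polytime_ext (f := fun e => head d (drop (f e) (l e)))).
  by move=> e; rewrite -nth0 nth_drop addn0.
by apply: polytime_head_of; apply: polytime_drop.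
Qed.

End Naturals.

#[export] Hint Resolve polytime_pred polytime_eq0 polytime_nth polytime_drop
  polytime_odd
  : polytime.

Section NaturalComparisons.
Context {E : Type} {eE : encoding E}.
Implicit Types f g : E -> nat.

Lemma polytime_subn f g :
  polytime f -> polytime g -> polytime (fun e => f e - g e).
Proof.
move=> pf pg; apply: (polytime_ext
  (f := fun e => size (drop (g e) (nseq (f e) tt)))).
  by move=> e; rewrite size_drop size_nseq.
by apply: (polytime_size tt); polytime.
Qed.

Lemma polytime_leq f g :
  polytime f -> polytime g -> polytime (fun e => f e <= g e).
Proof. by move=> pf pg; apply: polytime_eq0; apply: polytime_subn. Qed.

Lemma polytime_eqn f g :
  polytime f -> polytime g -> polytime (fun e => f e == g e).
Proof.
move=> pf pg; apply: (polytime_ext (f := fun e => (f e <= g e) && (g e <= f e))).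
  by move=> e; rewrite eqn_leq.
by apply: polytime_and; apply: polytime_leq.
Qed.

(** The list is built downwards from its last element, so that the counter is
    at the same time the next element. *)
Lemma polytime_iota f : polytime f -> polytime (fun e => iota 0 (f e)).
Proof.
move=> pf; pose step (s : nat * seq nat) (_ : unit) := (s.1.-1, s.1.-1 :: s.2).
apply: (polytime_ext
  (f := fun e => (foldl step (f e, [::]) (nseq (f e) tt)).2)).
  move=> e; rewrite -[RHS]cats0; move: (f e) [::] => n s.
  elim: n s => // n IH s; rewrite -[in RHS]addn1 iotaD -catA.
  exact: IH (n :: s).
apply: polytime_snd_of.
have [pr [g [pg cf]]] := pf.
apply: (polytime_foldl tt (f := fun _ : E => step)
  (Q := fun n => 3 * g n + (3 * g n) * (3 * g n))) => //.
- by polytime.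
- by polytime.
- by polytime.
- by poly_bound.
- move=> e i; rewrite size_nseq => le_i; have [le_g _] := cf e.
  rewrite take_nseq //.
  have -> : foldl step (f e, [::]) (nseq i tt) = (f e - i, iota (f e - i) i).
    elim: i le_i => [|i IH] le_i; first by rewrite subn0.
    rewrite -[nseq _ _]/(nseq i.+1 tt) -addn1 nseqD foldl_cat IH 1?ltnW //=.
    by rewrite /step addn1 subnS /= prednK ?subn_gt0.
  rewrite bits_of_pair; move: le_g; rewrite !bits_of_nat => le_g.
  have : bits_of (iota (f e - i) i) <= 1 + i * (2 * f e + 2); last by nia.
  have : f e - i + i <= f e by rewrite subnK.
  move: (f e - i) => j; elim: i j {le_i} => //= i IH j le_ij.
  rewrite bits_of_cons bits_of_nat; have := IH j.+1; lia.
Qed.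

End NaturalComparisons.

#[export] Hint Resolve polytime_subn polytime_leq polytime_eqn polytime_iota
  : polytime.

Lemma polytime_eqseq E (eE : encoding E) (f g : E -> seq nat) :
  polytime f -> polytime g -> polytime (fun e => f e == g e).
Proof.
move=> pf pg.
pose step (s : seq nat * bool) x :=
  (behead s.1, [&& s.2, ~~ nilp s.1 & head 0 s.1 == x]).
apply: (polytime_ext (f := fun e =>
  let s := foldl step (g e, true) (f e) in s.2 && nilp s.1)).
  move=> e /=; rewrite -[RHS]andTb; move: true.
  elim: (f e) (g e) => [|x s IH] [|y t] b //=; rewrite IH /= ?andbF //.
  by rewrite eqseq_cons [y == x]eq_sym andbA.
have pfold : polytime (fun e => foldl step (g e, true) (f e)).
  apply: (polytime_foldl_grow (f := fun _ : E => step) 0 (G := fun=> 3)) => //.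
  - apply: polytime_pair; first by polytime.
    apply: polytime_and; first by polytime.
    by polytime.
  - by polytime.
  - by poly_bound.
  - move=> e [t b] x; rewrite /step !bits_of_pair /=.
    have := bits_of_bool [&& b, ~~ nilp t & head 0 t == x].
    by case: t => [|y t] /=; rewrite ?bits_of_cons; lia.
by apply: polytime_and; polytime.
Qed.

#[export] Hint Resolve polytime_eqseq : polytime.

Import GRing.Theory Num.Theory Order.TTheory.

(** * Enumerating the monomials in graded lexicographic order *)

(** The exponents of total degree [k] in one more variable are obtained by
    putting [j] in front of the exponents of degree [k - j]. *)
Definition exponents_step (G : nat -> seq (seq nat)) (k : nat) :
    seq (seq nat) :=
  flatten [seq map (cons j) (G (k - j)) | j <- iota 0 k.+1].

Fixpoint exponents (n : nat) : nat -> seq (seq nat) :=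
  if n is n'.+1 then exponents_step (exponents n')
  else fun k => if k == 0 then [:: [::]] else [::].

Definition exponents_upto (n d : nat) : seq (seq nat) :=
  flatten [seq exponents n k | k <- iota 0 d.+1].

Lemma mem_exponents n k s :
  (s \in exponents n k) = (size s == n) && (sumn s == k).
Proof.
elim: n k s => [|n IH] k s.
  by case: s => [|x s] /=; case: k.
apply/flatten_mapP/idP.
  move=> [j]; rewrite mem_iota /= add0n ltnS => le_j /mapP[t].
  by rewrite IH => /andP[/eqP <- /eqP st] -> /=; rewrite st subnKC ?eqxx.
case: s => // x s; rewrite [size _]/= [sumn _]/= eqSS => /andP[szs /eqP sk].
exists x; first by rewrite mem_iota /= -sk ltnS leq_addr.
by rewrite map_f // IH szs -sk addKn /=.
Qed.

Lemma mem_exponents_upto n d s :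
  (s \in exponents_upto n d) = (size s == n) && (sumn s <= d).
Proof.
apply/flatten_mapP/idP => [[k]|/andP[szs le_d]].
  rewrite mem_iota /= add0n ltnS mem_exponents => le_k /andP[-> /eqP ->].
  by [].
by exists (sumn s); rewrite ?mem_iota ?mem_exponents ?szs ?eqxx // ltnS.
Qed.

Fixpoint lex_lt (s t : seq nat) : bool :=
  match s, t with
  | x :: s', y :: t' => (x < y) || (x == y) && lex_lt s' t'
  | _, _ => false
  end.

Lemma pairwise_flatten_map (T : eqType) (r : rel T) (F : nat -> seq T) a b :
  (forall j, pairwise r (F j)) ->
  (forall j j', j < j' -> {in F j & F j', forall x y, r x y}) ->
  pairwise r (flatten [seq F j | j <- iota a b]).
Proof.
move=> hF hFF; elim: b a => //= b IH a.
rewrite pairwise_cat hF IH !andbT; apply/allrelP => x y xF.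
case/flatten_mapP => j; rewrite mem_iota => /andP[lt_aj _] yF.
exact: (hFF _ _ lt_aj).
Qed.

(** The first exponent increases from one block to the next. *)
Lemma pairwise_exponents n k : pairwise lex_lt (exponents n k).
Proof.
elim: n k => [|n IH] k; first by case: k.
apply: pairwise_flatten_map => [j|j j' lt_j x y].
  rewrite pairwise_map; apply: sub_pairwise (IH _) => x y xy.
  by rewrite /= eqxx xy orbT.
by move=> /mapP[s _ ->] /mapP[t _ ->]; rewrite /= lt_j.
Qed.

Definition graded_lt (s t : seq nat) : bool :=
  (sumn s < sumn t) || (sumn s == sumn t) && lex_lt s t.

Lemma pairwise_exponents_upto n d : pairwise graded_lt (exponents_upto n d).
Proof.
apply: pairwise_flatten_map => [k|k k' lt_k x y]; last first.
  rewrite !mem_exponents => /andP[_ /eqP sx] /andP[_ /eqP sy].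
  by rewrite /graded_lt sx sy lt_k.
have : all (fun s => sumn s == k) (exponents n k).
  by apply/allP => s; rewrite mem_exponents => /andP[].
have := pairwise_exponents n k; elim: (exponents n k) => //= s l IH.
move=> /andP[/allP hs hl] /andP[/eqP sk /allP hk]; apply/andP; split.
  apply/allP => t tl; rewrite /graded_lt sk (eqP (hk t tl)) eqxx ltnn /=.
  exact: hs.
by apply: IH => //; apply/allP.
Qed.

Definition to_mnm n (s : seq nat) : 'X_{1..n} := [multinom nth 0 s i | i < n].

Lemma mdeg_to_mnm n s : size s = n -> mdeg (to_mnm n s) = sumn s.
Proof.
move=> <-; rewrite mdegE sumnE (big_nth 0) big_mkord.
by apply: eq_bigr => i _; rewrite mnmE.
Qed.

Lemma to_of_mnm n (m : 'X_{1..n}) : to_mnm n m = m.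
Proof. by apply/mnmP => i; rewrite mnmE -mnm_nth. Qed.

Lemma lex_ltP s t : size s = size t -> lex_lt s t ->
  exists2 i, i < size s &
    (forall j, j < i -> nth 0 s j = nth 0 t j) /\ nth 0 s i < nth 0 t i.
Proof.
elim: s t => [|x s IH] [|y t] //= [szst] /orP[lt_xy|/andP[/eqP <- /IH]].
  by exists 0.
by case=> // i lt_i [eq_i lt]; exists i.+1 => //; split=> // -[|j] //= /eq_i.
Qed.

Lemma graded_lt_mnm n s t : size s = n -> size t = n ->
  graded_lt s t -> (to_mnm n s < to_mnm n t)%O.
Proof.
move=> szs szt /orP[lt_st|/andP[/eqP eq_st lex]].
  by apply: lt_mdeg_ltmc; rewrite !mdeg_to_mnm.
apply/ltmcP; first by rewrite !mdeg_to_mnm.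
have [|i lt_i [eq_i lt]] := lex_ltP _ lex; first by rewrite szs.
rewrite szs in lt_i; exists (Ordinal lt_i); last by rewrite !mnmE.
by move=> j lt_j; rewrite !mnmE eq_i.
Qed.

(** Two strictly increasing lists with the same elements are equal. *)
Theorem monomialsE n d :
  monomials n d = [seq to_mnm n s | s <- exponents_upto n d].
Proof.
have lt_sorted : sorted <%O [seq to_mnm n s | s <- exponents_upto n d].
  apply/pairwise_sorted; rewrite pairwise_map.
  have : all (fun s => size s == n) (exponents_upto n d).
    by apply/allP => s; rewrite mem_exponents_upto => /andP[].
  have := pairwise_exponents_upto n d.
  elim: (exponents_upto n d) => //= s l IH.
  move=> /andP[/allP hs hl] /andP[/eqP sk /allP hk]; apply/andP; split.
    by apply/allP => t tl; apply: graded_lt_mnm (hs t tl) => //; apply/eqP/hk.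
  by apply: IH => //; apply/allP.
apply: (sorted_eq le_trans le_anti).
- by apply: sort_sorted; exact: le_total.
- by apply: sub_sorted lt_sorted => x y; exact: ltW.
rewrite /monomials perm_sort; apply: uniq_perm.
- by rewrite map_inj_uniq ?enum_uniq //; exact: val_inj.
- exact: (sorted_uniq lt_trans ltxx).
move=> m; apply/fintype.imageP/mapP => [[m' _ ->]|[s]].
  exists (bmnm m' : seq nat); last by rewrite to_of_mnm.
  rewrite mem_exponents_upto size_tuple eqxx /= -ltnS.
  by rewrite -(mdeg_to_mnm (size_tuple _)) to_of_mnm; exact: bmdeg.
rewrite mem_exponents_upto => /andP[/eqP szs le_d] ->.
have lt_d : mdeg (to_mnm n s) < d.+1 by rewrite mdeg_to_mnm ?ltnS.
by exists (BMultinom lt_d).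
Qed.

(** * The enumeration is polynomial in the number of coefficients *)

Definition exponent_table (n d : nat) : seq (seq (seq nat)) :=
  [seq exponents n k | k <- iota 0 d.+1].

Definition grow_table (d : nat) (G : seq (seq (seq nat))) :=
  [seq exponents_step (nth [::] G) k | k <- iota 0 d.+1].

Lemma grow_tableE n d : grow_table d (exponent_table n d) = exponent_table n.+1 d.
Proof.
apply/eq_in_map => k; rewrite mem_iota /= add0n ltnS => le_k.
congr (flatten _); apply/eq_in_map => j _.
by rewrite (nth_map 0) ?size_iota ?nth_iota ?ltnS // (leq_trans (leq_subr _ _)).
Qed.

(** Adding variables until the number of monomials is the number of
    coefficients recovers the number of variables. *)
Definition enumerate_table (A : Type) (d : nat) (l : seq A) :=
  foldl (fun G _ => if size (flatten G) == size l then G else grow_table d G)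
    (exponent_table 0 d) l.

Definition enumerate (A : Type) (d : nat) (l : seq A) : seq (seq nat) :=
  flatten (enumerate_table d l).

Lemma lex_lt_irreflexive : irreflexive lex_lt.
Proof. by elim=> //= x s IH; rewrite ltnn eqxx. Qed.

Lemma uniq_exponents_upto n d : uniq (exponents_upto n d).
Proof.
apply: pairwise_uniq (pairwise_exponents_upto n d) => s.
by rewrite /graded_lt ltnn eqxx lex_lt_irreflexive.
Qed.

(** Besides the old monomials there is at least the new variable itself;
    here [d > 0] matters. *)
Lemma size_exponents_upto_lt n d : 0 < d ->
  size (exponents_upto n d) < size (exponents_upto n.+1 d).
Proof.
move=> d0; pose l := rcons (map (cons 0) (exponents_upto n d)) (1 :: nseq n 0).
rewrite -[X in X < _](size_map (cons 0)) -(size_rcons _ (1 :: nseq n 0)).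
apply: uniq_leq_size => [|s].
  rewrite rcons_uniq map_inj_uniq ?uniq_exponents_upto ?andbT.
    by apply/mapP => -[].
  by move=> x y [].
rewrite mem_rcons inE => /orP[/eqP ->|/mapP[t]].
  by rewrite mem_exponents_upto /= size_nseq sumn_nseq eqxx mul0n.
by move=> tin ->; move: tin; rewrite !mem_exponents_upto /= eqSS add0n.
Qed.

Lemma size_exponents_upto_mono m n d : 0 < d ->
  m < n -> size (exponents_upto m d) < size (exponents_upto n d).
Proof.
move=> d0; elim: n => // n IH; rewrite ltnS leq_eqVlt => /orP[/eqP ->|lt_mn].
  exact: size_exponents_upto_lt.
exact: ltn_trans (IH lt_mn) (size_exponents_upto_lt _ d0).
Qed.

Lemma leq_size_exponents_upto n d : 0 < d -> n <= size (exponents_upto n d).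
Proof.
move=> d0; elim: n => // n IH.
exact: leq_ltn_trans IH (size_exponents_upto_lt _ d0).
Qed.

Lemma foldl_table (A : Type) d (l l' : seq A) :
  exists2 i, i <= size l' &
    foldl (fun G _ => if size (flatten G) == size l then G else grow_table d G)
      (exponent_table 0 d) l' = exponent_table i d.
Proof.
elim/last_ind: l' => [|l' x [i le_i IH]]; first by exists 0.
rewrite foldl_rcons IH size_rcons; case: ifP => _.
  by exists i; first exact: leqW.
exists i.+1; [exact: le_i | exact: grow_tableE].
Qed.

Lemma enumerateE (A : Type) n d (l : seq A) : 0 < d ->
  size l = size (exponents_upto n d) -> enumerate d l = exponents_upto n d.
Proof.
move=> d0 szl; rewrite /enumerate /enumerate_table.
have h l' : foldl (fun G _ => if size (flatten G) == size l then G
    else grow_table d G) (exponent_table 0 d) l' =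
    exponent_table (minn (size l') n) d.
  elim/last_ind: l' => [|l' x IH]; first by rewrite min0n.
  rewrite foldl_rcons IH size_rcons szl.
  have [le_n|lt_n] := leqP n (size l').
    by rewrite (minn_idPr (leqW le_n)) eqxx.
  rewrite (minn_idPl lt_n) grow_tableE ifF //; apply/negbTE.
  by rewrite neq_ltn (size_exponents_upto_mono d0 lt_n).
by rewrite h (minn_idPr _) // szl leq_size_exponents_upto.
Qed.

(** Splitting off the block in which the first exponent is 0 gives Pascal's
    recursion. *)
Lemma size_exponents n k : size (exponents n k) <= n.+1 ^ k.
Proof.
have sz n' k' : size (exponents n'.+1 k') =
    sumn [seq size (exponents n' (k' - j)) | j <- iota 0 k'.+1].
  rewrite size_flatten /shape -map_comp; congr sumn.
  by apply: eq_map => j /=; rewrite size_map.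
elim: n k => [|n IH] k; first by case: k => [|k]; rewrite ?exp1n.
elim: k => [|k IHk]; first by rewrite sz /= addn0 subnn; have := IH 0.
have -> : size (exponents n.+1 k.+1) =
    size (exponents n k.+1) + size (exponents n.+1 k).
  rewrite !sz -[iota 0 k.+2]/(0 :: iota (1 + 0) k.+1) iotaDl map_cons -map_comp.
  have sumn_cons x l : sumn (x :: l) = x + sumn l by [].
  by rewrite sumn_cons subn0.
apply: (@leq_trans (n.+1 ^ k.+1 + n.+2 ^ k)); first exact: leq_add.
rewrite [X in _ <= X]expnS mulSn addnC leq_add2l expnS leq_mul2l.
by case: k {IHk} => [|k]; rewrite ?expn0 ?orbT // leq_exp2r // leqnSn orbT.
Qed.

Lemma bits_of_seq_le A (eA : encoding A) (B : nat) (s : seq A) :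
  (forall i x0, i < size s -> bits_of (nth x0 s i) <= B) ->
  bits_of s <= size s * B.+1 + 1.
Proof.
elim: s => // x s IH h; rewrite bits_of_cons /= mulSn.
have h0 : bits_of x <= B by exact: (h 0 x).
have := IH (fun i x0 => h i.+1 x0); lia.
Qed.

Lemma bits_of_exponent_table n d :
  bits_of (exponent_table n d) <=
  d.+1 * (n.+1 ^ d * (n * (2 * d + 2) + 2) + 2) + 1.
Proof.
apply: leq_trans (bits_of_seq_le (B := n.+1 ^ d * (n * (2 * d + 2) + 2) + 1) _) _.
  rewrite size_map size_iota => k x0 lt_k.
  rewrite (nth_map 0) ?size_iota // nth_iota // add0n.
  apply: leq_trans (bits_of_seq_le (B := n * (2 * d + 2) + 1) _) _.
    move=> i x1 lt_i; set s := nth _ _ _.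
    have := mem_nth x1 lt_i; rewrite mem_exponents -/s => /andP[/eqP szs /eqP sk].
    apply: leq_trans (bits_of_seq_le (B := 2 * d + 1) _) _; last first.
      by rewrite szs -addnS.
    move=> j x2 lt_j; rewrite bits_of_nat.
    have le_d : nth x2 s j <= d.
      rewrite -ltnS; apply: leq_ltn_trans lt_k; rewrite -sk.
      by rewrite -[in X in _ <= X](cat_take_drop j s) sumn_cat (drop_nth x2 lt_j) /=;
         lia.
    by lia.
  rewrite -addnS leq_add2r leq_mul2r; apply/orP; right.
  apply: leq_trans (size_exponents n k) _; rewrite leq_pexp2l //.
by rewrite size_map size_iota -addnS.
Qed.

Section EnumeratePolytime.
Context {E A : Type} {eE : encoding E} {eA : encoding A}.

Lemma polytime_map_const (F : nat -> E -> A) (ks : seq nat) :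
  (forall k, polytime (F k)) -> polytime (fun e => [seq F k e | k <- ks]).
Proof.
move=> pF; elim: ks => [|k ks IH] /=; first by polytime.
by apply: polytime_cons.
Qed.

Lemma polytime_flatten_const (F : nat -> E -> seq A) (x0 : A) (ks : seq nat) :
  (forall k, polytime (F k)) -> polytime (fun e => flatten [seq F k e | k <- ks]).
Proof.
move=> pF; elim: ks => [|k ks IH] /=; first by polytime.
exact: polytime_cat x0 _ _ (pF k) IH.
Qed.

Lemma polytime_flatten (x0 : A) (g : E -> seq (seq A)) :
  polytime g -> polytime (fun e => flatten (g e)).
Proof.
move=> pg; apply: (polytime_ext
  (f := fun e => rev (foldl (fun s t => catrev t s) [::] (g e)))).
  move=> e; rewrite -[RHS]cat0s -[[::] in RHS]/(rev [::] : seq A).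
  elim: (g e) [::] => [|t s IH] r /=; first by rewrite cats0.
  by rewrite IH catrevE rev_cat revK catA.
apply: (polytime_rev x0).
apply: (polytime_foldl_grow (f := fun (_ : E) (s : seq A) (t : seq A) =>
  catrev t s) [::] (G := fun n => n)) => //.
- by apply: (polytime_catrev x0); polytime.
- by polytime.
- by poly_bound.
- move=> e s t; elim: t s => [|x t IH] s /=; first by rewrite leq_addr.
  by apply: leq_trans (IH _) _; rewrite !bits_of_cons; lia.
Qed.

End EnumeratePolytime.

Lemma polytime_grow_table d : polytime (grow_table d).
Proof.
apply: polytime_map_const => k; apply: (polytime_flatten_const [::]) => j.
apply: (polytime_map (f := fun _ s => j :: s) [::] [::]).
  by polytime.
by polytime.
Qed.

Lemma polytime_enumerate A (eA : encoding A) (x0 : A) d :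
  polytime (@enumerate A d).
Proof.
apply: (polytime_ext (f := fun l => flatten (enumerate_table d l))) => //.
apply: (polytime_flatten [::]).
pose Q n := d.+1 * (n.+1 ^ d * (n * (2 * d + 2) + 2) + 2) + 1.
have pQ : is_poly Q.
  have p1 : is_poly (fun n => n.+1).
    have [T hT] := is_poly_add is_poly_id (is_poly_const 1).
    by exists T => n; rewrite -hT addn1.
  rewrite /Q; apply: is_poly_add; last exact: is_poly_const.
  apply: is_poly_mul; first exact: is_poly_const.
  apply: is_poly_add; last exact: is_poly_const.
  by apply: is_poly_mul; [exact: is_poly_exp | poly_bound].
apply: (polytime_foldl x0 (f := fun (l : seq A) G (_ : A) =>
    if size (flatten G) == size l then G else grow_table d G) (Q := Q)) => //.
- apply: polytime_if.
  + apply: polytime_eqn.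
      by apply: (polytime_size [::]); apply: (polytime_flatten [::]); polytime.
    by apply: (polytime_size x0); polytime.
  + by polytime.
  + refine (polytime_comp (f := fun x : seq A * seq (seq (seq nat)) * A =>
      x.1.2) _ (polytime_grow_table d)); polytime.
- exact: polytime_const.
- exact: polytime_id.
- move=> l i le_i; have [j le_j ->] := foldl_table d l (take i l).
  apply: leq_trans (bits_of_exponent_table j d) _.
  apply: (is_poly_mono pQ); apply: leq_trans le_j _.
  by rewrite size_takel //; apply: leq_trans le_i (ltnW (size_bits_of _)).
Qed.

(** * Arithmetic on binary numbers and fractions *)

Notation natural := (seq bool).

Fixpoint nat_val (a : natural) : nat :=
  if a is x :: a' then x + (nat_val a').*2 else 0.

(** The zeros appended to [a] make the traversal exhaust [b] as well. *)
Definition padded (a b : natural) : natural := a ++ [seq false | _ <- b].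

Lemma nat_val_padded a b : nat_val (padded a b) = nat_val a.
Proof.
rewrite /padded; elim: a => [|x a IH] /=; last by rewrite IH.
by elim: b => //= x b ->.
Qed.

Lemma size_padded a b : size (padded a b) = size a + size b.
Proof. by rewrite size_cat size_map. Qed.

(** The state is the rest of the second number, the carry and the digits of
    the sum, the last one first. When the digits agree their value is the new
    carry; otherwise the carry goes through. *)
Definition add_step (s : natural * bool * natural) (x : bool) :=
  let y := head false s.1.1 in let c := s.1.2 in
  (behead s.1.1, if x == y then x else c,
   (if x == y then c else ~~ c) :: s.2).

Definition add_nat (a b : natural) : natural :=
  let s := foldl add_step (b, false, [::]) (padded a b) in
  rev (s.1.2 :: s.2).

Lemma nat_val_rcons a x : nat_val (rcons a x) = nat_val a + x * 2 ^ size a.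
Proof.
elim: a => [|y a IH] /=; first by rewrite doubleE; case: x.
by rewrite IH expnS; lia.
Qed.

Lemma add_natP a b : nat_val (add_nat a b) = nat_val a + nat_val b.
Proof.
rewrite /add_nat -(nat_val_padded a b) rev_cons nat_val_rcons size_rev.
have : size b <= size (padded a b) by rewrite size_padded leq_addl.
move: (padded a b) => l.
suff h c r : size b <= size l ->
    let s := foldl add_step (b, c, r) l in
    nat_val (rev s.2) + s.1.2 * 2 ^ size s.2 =
    nat_val (rev r) + 2 ^ size r * (c + nat_val l + nat_val b).
  by move=> /h /= ->; rewrite mul1n.
elim: l b c r => [|x l IH] b c r /=.
  by rewrite leqn0 => /nilP ->; rewrite !addn0 mulnC.
move=> le_b; rewrite IH; last by case: b le_b.
rewrite /= rev_cons nat_val_rcons size_rev expnS.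
by case: b {le_b} => [|y b] /=; case: x; try case: y; case: c => /=; lia.
Qed.

Lemma size_add_nat a b : size (add_nat a b) = (size a + size b).+1.
Proof.
rewrite /add_nat size_rev /= -size_padded; congr _.+1.
rewrite -[RHS]addn0 -[0]/(size ([::] : natural)).
move: b false [::] (padded a b) => b c r l.
by elim: l b c r => [|x l IH] b c r //=; rewrite IH /= addnS.
Qed.

(** Later digits weigh more, so the last difference decides. *)
Definition leq_step (s : natural * bool) (x : bool) :=
  let y := head false s.1 in (behead s.1, if x == y then s.2 else y).

Definition leq_nat (a b : natural) : bool :=
  (foldl leq_step (b, true) (padded a b)).2.

Lemma leq_natP a b : leq_nat a b = (nat_val a <= nat_val b).
Proof.
rewrite /leq_nat -(nat_val_padded a b).
have : size b <= size (padded a b) by rewrite size_padded leq_addl.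
move: (padded a b) => l.
suff h c : size b <= size l -> (foldl leq_step (b, c) l).2 =
    (nat_val l < nat_val b) || (nat_val l == nat_val b) && c.
  by move=> /h ->; rewrite andbT orbC -leq_eqVlt.
elim: l b c => [|x l IH] b c /=; first by rewrite leqn0 => /nilP ->.
move=> le_b; rewrite IH; last by case: b le_b.
by case: b {le_b} => [|y b] /=; case: x; try case: y; case: c => /=; lia.
Qed.

(** Horner's scheme in base two, from the most significant digit on. *)
Definition mul_nat (a b : natural) : natural :=
  foldl (fun acc (x : bool) => add_nat (false :: acc) (if x then b else [::]))
    [::] (rev a).

Lemma mul_natP a b : nat_val (mul_nat a b) = nat_val a * nat_val b.
Proof.
rewrite /mul_nat; elim: a => //= x a IH.
rewrite rev_cons foldl_rcons add_natP /= IH.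
by case: x => /=; lia.
Qed.

Lemma bits_of_natural (a : natural) :
  2 * size a < bits_of a <= 4 * size a + 1.
Proof.
elim: a => // x a IH; rewrite bits_of_cons /=.
by have := bits_of_bool x; have := bits_of_gt0 encoding_bool x; lia.
Qed.

Section NaturalsPolytime.
Context {E : Type} {eE : encoding E}.
Implicit Types f g : E -> natural.

Lemma polytime_padded f g :
  polytime f -> polytime g -> polytime (fun e => padded (f e) (g e)).
Proof.
move=> pf pg; apply: (polytime_cat false) => //.
by apply: (polytime_map false false) => //; apply: polytime_const.
Qed.

Lemma polytime_add_nat f g :
  polytime f -> polytime g -> polytime (fun e => add_nat (f e) (g e)).
Proof.
move=> pf pg; have ps : polytime (fun e =>
    foldl add_step (g e, false, [::]) (padded (f e) (g e))).
  apply: (polytime_foldl_grow (f := fun _ : E => add_step) false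
    (G := fun=> 10)) => //.
  - by rewrite /add_step; polytime.
  - by polytime.
  - exact: polytime_padded.
  - by poly_bound.
  - move=> e [[b c] r] x; rewrite /add_step /= !bits_of_pair bits_of_cons.
    set c1 := if _ then _ else _; set c2 := if _ then _ else _.
    have := bits_of_bool c1; have := bits_of_bool c2; have := bits_of_gt0 encoding_bool c.
    have le_b : bits_of (behead b) <= bits_of b.
      by case: b {c1 c2} => //= y b; rewrite bits_of_cons; lia.
    by lia.
by apply: (polytime_rev false); polytime.
Qed.

Lemma polytime_leq_nat f g :
  polytime f -> polytime g -> polytime (fun e => leq_nat (f e) (g e)).
Proof.
move=> pf pg; apply: polytime_snd_of.
apply: (polytime_foldl_grow (f := fun _ : E => leq_step) false
    (G := fun=> 10)) => //.
- by rewrite /leq_step; polytime.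
- by polytime.
- exact: polytime_padded.
- by poly_bound.
- move=> e [b c] x; rewrite /leq_step /= !bits_of_pair.
  set c1 := if _ then _ else _.
  have := bits_of_bool c1; have := bits_of_gt0 encoding_bool c.
  have le_b : bits_of (behead b) <= bits_of b.
    by case: b {c1} => //= y b; rewrite bits_of_cons; lia.
  by lia.
Qed.
End NaturalsPolytime.

#[export] Hint Resolve polytime_add_nat polytime_leq_nat : polytime.

(** Each round lengthens the accumulator by a fixed amount, since an addition
    adds the lengths of its arguments. *)
Lemma polytime_mul_nat E (eE : encoding E) (f g : E -> natural) :
  polytime f -> polytime g -> polytime (fun e => mul_nat (f e) (g e)).
Proof.
move=> pf pg; have [pr [u [pu cf]]] := pf; have [pr' [v [pv cg]]] := pg.
pose step e (acc : natural) (x : bool) :=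
  add_nat (false :: acc) (if x then g e else [::]).
apply: (polytime_foldl (f := step) false
  (Q := fun n => 4 * (u n * (v n + 2)) + 1)).
- apply: polytime_add_nat; first by polytime.
  apply: polytime_if; [by polytime | | by polytime].
  by refine (polytime_comp (f := fun x : E * natural * bool => x.1.1) _ pg);
     polytime.
- by polytime.
- exact: (polytime_rev false).
- by poly_bound.
- move=> e i; rewrite size_rev => le_i.
  have [le_u _] := cf e; have [le_v _] := cg e.
  set r := foldl _ _ _.
  have sz : size r <= i * (size (g e) + 2).
    rewrite /r -[size (f e)](size_rev) in le_i *.
    elim: i le_i {r} => [|i IH] le_i; first by rewrite take0.
    rewrite (take_nth false le_i) foldl_rcons {1}/step size_add_nat /=.
    by have := IH (ltnW le_i); case: ifP => _ /=; nia.
  have /andP[lt_f _] := bits_of_natural (f e).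
  have /andP[lt_g _] := bits_of_natural (g e).
  have /andP[_ le_r] := bits_of_natural r.
  apply: leq_trans le_r _; rewrite leq_add2r leq_mul2l /=.
  by apply: leq_trans sz _; apply: leq_mul; lia.
Qed.

#[export] Hint Resolve polytime_mul_nat : polytime.

Local Open Scope ring_scope.

(** Differences of naturals, and quotients of such differences, avoid both
    subtraction and the reduction of fractions. *)
Notation difference := (natural * natural)%type.
Notation fraction := (difference * difference)%type.

Definition diff_val (z : difference) : rat :=
  (nat_val z.1)%:R - (nat_val z.2)%:R.

Definition diff_add (y z : difference) : difference :=
  (add_nat y.1 z.1, add_nat y.2 z.2).
Definition diff_mul (y z : difference) : difference :=
  (add_nat (mul_nat y.1 z.1) (mul_nat y.2 z.2),
   add_nat (mul_nat y.1 z.2) (mul_nat y.2 z.1)).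
Definition diff_opp (z : difference) : difference := (z.2, z.1).
Definition diff_ge0 (z : difference) : bool := leq_nat z.2 z.1.
Definition diff_eq0 (z : difference) : bool :=
  diff_ge0 z && diff_ge0 (diff_opp z).

Lemma diff_addP y z : diff_val (diff_add y z) = diff_val y + diff_val z.
Proof. by rewrite /diff_val /= !add_natP !natrD; ring. Qed.

Lemma diff_mulP y z : diff_val (diff_mul y z) = diff_val y * diff_val z.
Proof. by rewrite /diff_val /= !add_natP !mul_natP !natrD !natrM; ring. Qed.

Lemma diff_oppP z : diff_val (diff_opp z) = - diff_val z.
Proof. by rewrite /diff_val /= opprB. Qed.

Lemma diff_ge0P z : diff_ge0 z = (0 <= diff_val z).
Proof. by rewrite /diff_ge0 leq_natP /diff_val subr_ge0 ler_nat. Qed.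

Lemma diff_eq0P z : diff_eq0 z = (diff_val z == 0).
Proof. by rewrite /diff_eq0 !diff_ge0P diff_oppP oppr_ge0 andbC eq_le. Qed.

Definition frac_val (q : fraction) : rat := diff_val q.1 / diff_val q.2.

(** A zero denominator stands for the value zero, as division by zero does. *)
Definition frac_add (p q : fraction) : fraction :=
  if diff_eq0 p.2 then q else
  if diff_eq0 q.2 then p else
  (diff_add (diff_mul p.1 q.2) (diff_mul q.1 p.2), diff_mul p.2 q.2).
Definition frac_mul (p q : fraction) : fraction :=
  (diff_mul p.1 q.1, diff_mul p.2 q.2).
Definition frac_opp (p : fraction) : fraction := (diff_opp p.1, p.2).
Definition frac_inv (p : fraction) : fraction := (p.2, p.1).
(** A quotient and a product have the same sign. *)
Definition frac_ge0 (p : fraction) : bool := diff_ge0 (diff_mul p.1 p.2).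

Lemma frac_addP p q : frac_val (frac_add p q) = frac_val p + frac_val q.
Proof.
rewrite /frac_add !diff_eq0P.
case: eqP => [p0|/eqP p0]; first by rewrite /frac_val p0 invr0 mulr0 add0r.
case: eqP => [q0|/eqP q0]; first by rewrite /frac_val q0 invr0 mulr0 addr0.
by rewrite /frac_val /= diff_addP !diff_mulP; field; rewrite p0 q0.
Qed.

Lemma frac_mulP p q : frac_val (frac_mul p q) = frac_val p * frac_val q.
Proof. by rewrite /frac_val /= !diff_mulP invfM mulrACA. Qed.

Lemma frac_oppP p : frac_val (frac_opp p) = - frac_val p.
Proof. by rewrite /frac_val /= diff_oppP mulNr. Qed.

Lemma frac_invP p : frac_val (frac_inv p) = (frac_val p)^-1.
Proof. by rewrite /frac_val /= invf_div. Qed.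

Lemma frac_ge0P p : frac_ge0 p = (0 <= frac_val p).
Proof.
rewrite /frac_ge0 diff_ge0P diff_mulP /frac_val.
have [->|p0] := eqVneq (diff_val p.2) 0; first by rewrite invr0 !mulr0.
have -> : diff_val p.1 * diff_val p.2 =
    diff_val p.1 / diff_val p.2 * diff_val p.2 ^+ 2 by field.
by rewrite pmulr_lge0 // exprn_even_gt0.
Qed.

Lemma nat_val_bits n : nat_val (bits n) = n.
Proof.
rewrite /bits; have : (n < 2 ^ (trunc_log 2 n).+1)%N by apply: trunc_log_ltn.
move: (trunc_log 2 n).+1 => k; elim: k n => [|k IH] n.
  by rewrite expn0 ltnS leqn0 => /eqP ->.
move=> lt_n; rewrite -[RHS](odd_double_half n) /mkseq /= divn1.
rewrite -[iota 1 k]/(iota (1 + 0) k) iotaDl -map_comp.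
have := IH n./2; rewrite /mkseq => <-; last first.
  by rewrite -divn2 ltn_divLR // -expnSr.
congr (_ + (nat_val _).*2)%N. apply: eq_map => i /=.
by rewrite add1n expnS divnMA divn2.
Qed.

Definition frac_of (q : rat) : fraction :=
  let n := bits `|numq q|%N in
  (if q < 0 then ([::], n) else (n, [::]), (bits `|denq q|%N, [::])).

Lemma frac_ofP q : frac_val (frac_of q) = q.
Proof.
rewrite /frac_val /frac_of /=; set n := bits _; set m := bits _.
have hn : nat_val n = `|numq q|%N by exact: nat_val_bits.
have hm : nat_val m = `|denq q|%N by exact: nat_val_bits.
clearbody n m; have -> : diff_val (m, [::]) = (denq q)%:~R.
  by rewrite /diff_val /= hm subr0 pmulrn absz_denq.
rewrite -[RHS]divq_num_den; congr (_ / _).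
rewrite -numq_lt0; case: ltP => q0; rewrite /diff_val /= hn ?sub0r ?subr0.
  by rewrite pmulrn abszE ltr0_norm // mulrNz opprK.
by rewrite pmulrn abszE ger0_norm.
Qed.

(** * Functions with rational values computed in polynomial time *)

Section RationalFunctions.
Context {E : Type} {eE : encoding E}.

(** The rational values are represented by fractions in no particular form, so
    arithmetic needs no gcd; the length grows at each operation, and is
    polynomial as long as the number of operations is constant. *)
Definition polytime_rat (g : E -> rat) : Prop :=
  exists2 f : E -> fraction, polytime f & forall e, frac_val (f e) = g e.

Lemma polytime_rat_ext g g' : g =1 g' -> polytime_rat g -> polytime_rat g'.
Proof. by move=> eqg [f pf hf]; exists f => // e; rewrite hf eqg. Qed.

Lemma polytime_rat_const r : polytime_rat (fun=> r).
Proof.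
by exists (fun=> frac_of r) => [|e]; [exact: polytime_const | rewrite frac_ofP].
Qed.

Lemma polytime_rat_add g h :
  polytime_rat g -> polytime_rat h -> polytime_rat (fun e => g e + h e).
Proof.
move=> [f pf hf] [f' pf' hf']; exists (fun e => frac_add (f e) (f' e)).
  by rewrite /frac_add /diff_eq0 /diff_ge0 /diff_add /diff_mul /diff_opp /=;
     polytime.
by move=> e; rewrite frac_addP hf hf'.
Qed.

Lemma polytime_rat_mul g h :
  polytime_rat g -> polytime_rat h -> polytime_rat (fun e => g e * h e).
Proof.
move=> [f pf hf] [f' pf' hf']; exists (fun e => frac_mul (f e) (f' e)).
  by rewrite /frac_mul /diff_mul /=; polytime.
by move=> e; rewrite frac_mulP hf hf'.
Qed.

Lemma polytime_rat_opp g : polytime_rat g -> polytime_rat (fun e => - g e).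
Proof.
move=> [f pf hf]; exists (fun e => frac_opp (f e)).
  by rewrite /frac_opp /diff_opp; polytime.
by move=> e; rewrite frac_oppP hf.
Qed.

Lemma polytime_rat_inv g : polytime_rat g -> polytime_rat (fun e => (g e)^-1).
Proof.
move=> [f pf hf]; exists (fun e => frac_inv (f e)).
  by rewrite /frac_inv; polytime.
by move=> e; rewrite frac_invP hf.
Qed.

Lemma polytime_rat_sub g h :
  polytime_rat g -> polytime_rat h -> polytime_rat (fun e => g e - h e).
Proof.
by move=> pg ph; apply: polytime_rat_add => //; apply: polytime_rat_opp.
Qed.

Lemma polytime_rat_if (b : E -> bool) g h :
  polytime b -> polytime_rat g -> polytime_rat h ->
  polytime_rat (fun e => if b e then g e else h e).
Proof.
move=> pb [f pf hf] [f' pf' hf'].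
exists (fun e => if b e then f e else f' e); first by polytime.
by move=> e; rewrite -hf -hf'; case: (b e).
Qed.

Lemma polytime_rat_ge0 g : polytime_rat g -> polytime (fun e => 0 <= g e).
Proof.
move=> [f pf hf]; apply: (polytime_ext (f := fun e => frac_ge0 (f e))).
  by move=> e; rewrite frac_ge0P hf.
by rewrite /frac_ge0 /diff_ge0 /diff_mul /=; polytime.
Qed.

Lemma polytime_rat_eq0 g : polytime_rat g -> polytime (fun e => g e == 0).
Proof.
move=> pg; apply: (polytime_ext (f := fun e => (0 <= g e) && (0 <= - g e))).
  by move=> e; rewrite oppr_ge0 andbC eq_le.
by apply: polytime_and; apply: polytime_rat_ge0 => //; apply: polytime_rat_opp.
Qed.

Lemma polytime_rat_eq g h :
  polytime_rat g -> polytime_rat h -> polytime (fun e => g e == h e).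
Proof.
move=> pg ph; apply: (polytime_ext (f := fun e => g e - h e == 0)).
  by move=> e; rewrite subr_eq0.
by apply: polytime_rat_eq0; apply: polytime_rat_sub.
Qed.

Lemma polytime_rat_sg g : polytime_rat g -> polytime_rat (fun e => Num.sg (g e)).
Proof.
move=> pg; apply: (polytime_rat_ext (g := fun e =>
  if g e == 0 then 0 else if 0 <= g e then 1 else - 1)).
  by move=> e; case: (sgrP (g e)).
apply: polytime_rat_if; [exact: polytime_rat_eq0|exact: polytime_rat_const|].
by apply: polytime_rat_if; [exact: polytime_rat_ge0 | exact: polytime_rat_const..].
Qed.

End RationalFunctions.

(** * Deciding the sign of a univariate polynomial of bounded degree *)

Section CauchyIndex.
Variable R : rcfType.
Implicit Types p q g : {poly R}.

(** The signed remainder of pseudo-division differs from that of Euclidean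
    division by a square factor, which changes no sign. *)
Lemma cindexR_modp p q :
  cindexR q p = crossR (p * q) - cindexR (p %% q) q.
Proof.
rewrite cindexR_rec; congr (_ + _).
have [->|q0] := eqVneq q 0.
  by rewrite /cindexR rootsR0 !big_nil oppr0.
set c := lead_coef q ^+ Pdiv.Ring.rscalp p q.
have c0 : c != 0 by rewrite expf_neq0 ?lead_coef_eq0.
have -> : next_mod p q = - c ^+ 2 *: (p %% q).
  rewrite /next_mod modpE scalerA -/c expr2.
  by rewrite mulNr mulfK.
rewrite /cindexR -sumrN; apply: eq_bigr => x _.
by rewrite jump_mulCp sgzN gtr0_sgz ?exprn_even_gt0 ?mulN1r.
Qed.

(** A polynomial that is positive at both ends of the line and negative
    somewhere is negative at a critical point, between two of its roots. *)
Lemma negative_critical_point g x :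
  0 < lead_coef g -> odd (size g) -> g.[x] < 0 ->
  exists2 y, root g^`() y & g.[y] < 0.
Proof.
move=> lg og gx.
have g0 : g != 0 by rewrite -lead_coef_eq0 gt_eqF.
have pinf : sgp_pinfty g = 1 by rewrite /sgp_pinfty gtr0_sg.
have minf : sgp_minfty g = 1.
  rewrite /sgp_minfty -signr_odd.
  have -> : odd (size g).-1 = false.
    by move: og; rewrite -[size g]prednK ?size_poly_gt0 //= => /negbTE.
  by rewrite mul1r gtr0_sg.
pose c := cauchy_bound g.
have gc : 0 < g.[c].
  by rewrite -sgr_gt0 (sgp_pinftyP (ge_cauchy_bound g0)) ?pinf // in_itv /= lexx.
have gNc : 0 < g.[- c].
  by rewrite -sgr_gt0 (sgp_minftyP (le_cauchy_bound g0)) ?minf // in_itv /= lexx.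
have x_lt : x < c.
  rewrite ltNge; apply/negP => le_cx.
  move: gx; rewrite -sgr_lt0 (sgp_pinftyP (ge_cauchy_bound g0)) ?pinf ?ltr10 //.
  by rewrite in_itv /= le_cx.
have x_gt : - c < x.
  rewrite ltNge; apply/negP => le_xc.
  move: gx; rewrite -sgr_lt0 (sgp_minftyP (le_cauchy_bound g0)) ?minf ?ltr10 //.
have [y1 [gy1 y1x nr1]] :
    exists y, [/\ g.[y] = 0, y < x & {in `]y, x[, forall z, ~~ root g z}].
  case: (prev_rootP g (- c) x) => [/eqP|y _ gy yx nr|z _ _ nr].
  - by rewrite (negPf g0).
  - by exists y; rewrite (itvP yx).
  - have [|y yx ry] := @poly_ivtoo _ g (- c) x (ltW x_gt).
      by rewrite pmulr_rlt0.
    by have := nr y yx; rewrite ry.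
have [y2 [gy2 xy2 nr2]] :
    exists y, [/\ g.[y] = 0, x < y & {in `]x, y[, forall z, ~~ root g z}].
  case: (next_rootP g x c) => [/eqP|y _ gy yx nr|z _ _ nr].
  - by rewrite (negPf g0).
  - by exists y; rewrite (itvP yx).
  - have [|y yx ry] := @poly_ivtoo _ g x c (ltW x_lt).
      by rewrite pmulr_llt0.
    by have := nr y yx; rewrite ry.
have [|y yI g'y] := @poly_rolle _ y1 y2 g (lt_trans y1x xy2).
  by rewrite gy1 gy2.
exists y; first exact/rootP.
have nr : {in `]y1, y2[, forall z, ~~ root g z}.
  move=> z zI; have [zx|xz|->] := ltgtP z x.
  - by apply: nr1; rewrite in_itv /= (itvP zI).
  - by apply: nr2; rewrite in_itv /= xz (itvP zI).
  - by rewrite rootE lt_eqF.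
rewrite -sgr_lt0 (polyrN0_itv nr (_ : x \in _) yI) ?sgr_lt0 //.
by rewrite in_itv /= y1x.
Qed.

Lemma nonnegative_infinity g :
  (forall x, 0 <= g.[x]) -> g != 0 -> 0 < lead_coef g /\ odd (size g).
Proof.
move=> ge0 g0.
have pinf : 0 <= sgp_pinfty g.
  rewrite -(sgp_pinftyP (ge_cauchy_bound g0) (_ : cauchy_bound g \in _)).
    by rewrite sgr_ge0.
  by rewrite in_itv /= lexx.
have minf : 0 <= sgp_minfty g.
  rewrite -(sgp_minftyP (le_cauchy_bound g0) (_ : - cauchy_bound g \in _)).
    by rewrite sgr_ge0.
  by rewrite in_itv /= lexx.
have lg : 0 < lead_coef g.
  by rewrite lt_neqAle eq_sym lead_coef_eq0 g0 -sgr_ge0.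
split=> //; move: minf; rewrite /sgp_minfty sgr_ge0 pmulr_lge0 // -signr_odd.
have -> : odd (size g) = ~~ odd (size g).-1 by rewrite -oddS prednK ?size_poly_gt0.
by case: (odd _) => //; rewrite expr1 ler0N1.
Qed.

(** The two indices are the sums of the signs of [g ^+ 2] and of [g] over the
    roots of the derivative: they agree if and only if [g] is nonnegative at
    all its critical points. *)
Lemma nonnegativeP g :
  (forall x, 0 <= g.[x]) <->
  [|| g == 0 | [&& 0 < lead_coef g, odd (size g) &
     cindexR (g^`()^`() * (g * g)) g^`() == cindexR (g^`()^`() * g) g^`()]].
Proof.
rewrite -!changes_mods_cindex -!/(taqR _ _) -!taq_taqR /taq.
split=> [ge0|/orP[/eqP -> x|/and3P[lg og /eqP eqt] x]].
- have [//|g0] := eqVneq g 0; have [-> ->] := nonnegative_infinity ge0 g0.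
  apply/eqP/eq_bigr => y _; rewrite hornerM sgzM.
  by case: sgzP (ge0 y) => //; rewrite ?mulr0 // leNgt => ->.
- by rewrite horner0.
- rewrite leNgt; apply/negP => gx.
  have [y ry gy] := negative_critical_point lg og gx.
  have g'0 : g^`() != 0.
    apply: contraTneq gx => g'0; rewrite -leNgt.
    have sg : (size g <= 1)%N by rewrite -subn_eq0 subn1 -size_deriv g'0 size_poly0.
    by move: lg; rewrite (size1_polyC sg) lead_coefC hornerC => /ltW.
  have yR : y \in rootsR g^`() by rewrite -roots_on_rootsR // in_itv.
  have pos z : 0 <= sgz (g * g).[z] - sgz g.[z].
    by rewrite hornerM sgzM; case: sgzP.
  have : \sum_(z <- rootsR g^`()) (sgz (g * g).[z] - sgz g.[z]) = 0.
    by rewrite sumrB eqt subrr.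
  move/eqP; rewrite psumr_eq0 // => /allP/(_ y yR).
  by rewrite hornerM sgzM ltr0_sgz.
Qed.

End CauchyIndex.

(** Polynomials of bounded size whose coefficients are polynomial-time
    functions of an argument. Since the bound is a constant, the recursions on
    degrees below are unfolded into finitely many arithmetic operations. *)
Section BoundedPolynomials.
Context {E : Type} {eE : encoding E}.
Implicit Types (g h : E -> {poly rat}) (N : nat).

Definition polytime_poly N g : Prop :=
  (forall e, (size (g e) <= N)%N) /\
  forall i, polytime_rat (fun e => (g e)`_i).

Lemma polytime_poly_ext N g h : g =1 h -> polytime_poly N g -> polytime_poly N h.
Proof.
move=> eqg [szg pg]; split=> [e|i]; first by rewrite -eqg.
by apply: polytime_rat_ext (pg i) => e; rewrite eqg.
Qed.

Lemma polytime_poly_widen N N' g :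
  (forall e, (size (g e) <= N')%N) -> polytime_poly N g -> polytime_poly N' g.
Proof. by move=> szg [_ pg]. Qed.

(** A bounded index is handled by finitely many branches. *)
Lemma polytime_rat_case N (s : E -> nat) (g : nat -> E -> rat) :
  polytime s -> (forall e, (s e <= N)%N) -> (forall k, polytime_rat (g k)) ->
  polytime_rat (fun e => g (s e) e).
Proof.
move=> ps le_s pg.
pose G := fix G n e := if n is m.+1 then if s e == n then g n e else G m e
                       else g 0%N e.
have pG n : polytime_rat (G n).
  elim: n => [|n IH]; first exact: pg.
  by apply: polytime_rat_if => //; apply: polytime_eqn => //;
     exact: polytime_const.
apply: polytime_rat_ext (pG N) => e; have := le_s e.
elim: N {le_s} => [|n IH] /=; first by rewrite leqn0 => /eqP ->.
by rewrite leq_eqVlt ltnS; case: eqP => [->|_] //= /IH.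
Qed.

Lemma polytime_poly_size N g :
  polytime_poly N g -> polytime (fun e => size (g e)).
Proof.
move=> [szg pg].
pose S := fix S n e := if n is m.+1 then if (g e)`_m == 0 then S m e else n
                       else 0%N.
have pS n : polytime (S n).
  elim: n => [|n IH]; first exact: polytime_const.
  apply: polytime_if => //; last exact: polytime_const.
  exact: polytime_rat_eq0.
apply: polytime_ext (pS N) => e; have := szg e.
elim: N {szg} => [|n IH] /=; first by rewrite leqn0 => /eqP ->.
move=> le_n; case: eqP => [g0|/eqP g0].
  by apply: IH; apply/leq_sizeP => j; rewrite leq_eqVlt => /orP[/eqP <- //|];
     exact: (leq_sizeP _ _ le_n).
by apply/eqP; rewrite eqn_leq le_n andbT ltnNge; apply: contra g0 => sz;
   rewrite nth_default.
Qed.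

Lemma polytime_lead_coef N g :
  polytime_poly N g -> polytime_rat (fun e => lead_coef (g e)).
Proof.
move=> pg; apply: (polytime_rat_case (N := N)
  (g := fun k e => (g e)`_k) (s := fun e => (size (g e)).-1)).
- by apply: polytime_pred; exact: polytime_poly_size pg.
- by move=> e; apply: leq_trans (leq_pred _) (pg.1 e).
- exact: pg.2.
Qed.

Lemma polytime_rat_sum (F : nat -> E -> rat) n :
  (forall i, polytime_rat (F i)) ->
  polytime_rat (fun e => \sum_(i < n) F i e).
Proof.
move=> pF; elim: n => [|n IH].
  by apply: polytime_rat_ext (polytime_rat_const 0) => e; rewrite big_ord0.
apply: (polytime_rat_ext (g := fun e => \sum_(i < n) F i e + F n e)).
  by move=> e; rewrite big_ord_recr.
exact: polytime_rat_add.
Qed.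

Lemma polytime_poly_mul N g N' h :
  polytime_poly N g -> polytime_poly N' h ->
  polytime_poly (N + N') (fun e => g e * h e).
Proof.
move=> [szg pg] [szh ph]; split=> [e|i].
  apply: leq_trans (size_polyMleq _ _) _; apply: leq_trans (leq_pred _) _.
  exact: leq_add.
apply: (polytime_rat_ext
  (g := fun e => \sum_(j < i.+1) (g e)`_j * (h e)`_(i - j))).
  by move=> e; rewrite coefM.
apply: (polytime_rat_sum (F := fun j e => (g e)`_j * (h e)`_(i - j))) => j.
exact: polytime_rat_mul.
Qed.

Lemma polytime_poly_deriv N g :
  polytime_poly N g -> polytime_poly N (fun e => (g e)^`()).
Proof.
move=> [szg pg]; split=> [e|i].
  by rewrite size_deriv; apply: leq_trans (leq_pred _) (szg e).
apply: (polytime_rat_ext (g := fun e => (g e)`_i.+1 * i.+1%:R)).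
  by move=> e; rewrite coef_deriv mulr_natr.
by apply: polytime_rat_mul => //; exact: polytime_rat_const.
Qed.

Lemma polytime_poly_opp N g :
  polytime_poly N g -> polytime_poly N (fun e => - g e).
Proof.
move=> [szg pg]; split=> [e|i]; first by rewrite size_polyN.
apply: (polytime_rat_ext (g := fun e => - (g e)`_i)).
  by move=> e; rewrite coefN.
exact: polytime_rat_opp.
Qed.

Lemma polytime_poly_eq0 N g : polytime_poly N g -> polytime (fun e => g e == 0).
Proof.
move=> pg; apply: (polytime_ext (f := fun e => size (g e) == 0%N)).
  by move=> e; rewrite size_poly_eq0.
by apply: polytime_eq0; exact: polytime_poly_size pg.
Qed.

End BoundedPolynomials.

Section Division.
Implicit Types p q : {poly rat}.

(** Euclidean division is unrolled into steps so that coefficients are rational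
    functions of coefficients, with a case distinction on the sizes only. *)
Definition division_step p q : {poly rat} :=
  if (size p < size q)%N then p
  else p - (lead_coef p / lead_coef q) *: ('X^(size p - size q) * q).

Lemma division_step_modp p q : division_step p q %% q = p %% q.
Proof.
rewrite /division_step; case: ifP => // _.
by rewrite modpD modpN modpZl modp_mull scaler0 oppr0 addr0.
Qed.

Lemma coef_division_step p q i :
  (division_step p q)`_i =
  if (size p < size q)%N then p`_i else
  p`_i - (lead_coef p / lead_coef q) *
    (if (i < size p - size q)%N then 0 else q`_(i - (size p - size q))).
Proof.
by rewrite /division_step; case: ifP => // _; rewrite coefB coefZ coefXnM.
Qed.

Lemma size_division_step p q :
  q != 0 -> (size q <= size p)%N -> (size (division_step p q) < size p)%N.
Proof.
move=> q0 le_qp; have q_gt0 : (0 < size q)%N by rewrite size_poly_gt0.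
rewrite -[ltnRHS]prednK ?(leq_trans q_gt0) // ltnS; apply/leq_sizeP => j le_j.
rewrite coef_division_step ltnNge le_qp /= ifF; last first.
  by move: le_qp q_gt0 le_j {q0}; move: (size p) (size q) => a b; lia.
have [->|ne_j] := eqVneq j (size p).-1.
  have -> : ((size p).-1 - (size p - size q) = (size q).-1)%N.
    by move: le_qp q_gt0 {q0}; move: (size p) (size q) => a b; lia.
  by rewrite -!lead_coefE divfK ?subrr // lead_coef_eq0.
have [szp szq] : (size p <= j /\ size q <= j - (size p - size q))%N.
  move: le_qp q_gt0 le_j ne_j {q0}; move: (size p) (size q) => a b.
  by move=> *; split; lia.
by rewrite !nth_default ?mulr0 ?subrr.
Qed.

Lemma size_division_step_le p q : (size (division_step p q) <= size p)%N.
Proof.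
have [q0|q0] := eqVneq q 0.
  by rewrite /division_step q0 size_poly0 ltn0 mulr0 scaler0 subr0.
have [le_qp|lt_pq] := leqP (size q) (size p).
  exact: ltnW (size_division_step q0 le_qp).
by rewrite /division_step lt_pq.
Qed.

Lemma iter_division_step p q n :
  q != 0 -> (size p <= n)%N -> iter n (division_step^~ q) p = p %% q.
Proof.
move=> q0; elim: n p => [|n IH] p le_n.
  by move: le_n; rewrite leqn0 size_poly_eq0 => /eqP ->; rewrite mod0p.
rewrite iterSr -(division_step_modp p q).
have [lt_pq|le_qp] := ltnP (size p) (size q); last first.
  by apply: IH; rewrite -ltnS; apply: leq_trans (size_division_step q0 le_qp) _.
have eq_p : division_step p q = p by rewrite /division_step lt_pq.
have -> : iter n (division_step^~ q) (division_step p q) = p.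
  by rewrite eq_p; elim: n {IH le_n} => //= n ->.
by rewrite eq_p modp_small.
Qed.

End Division.

Section SturmPolytime.
Context {E : Type} {eE : encoding E}.
Variables (R : rcfType).
Implicit Types (g p q : E -> {poly rat}) (N : nat).

Lemma polytime_division_step N p q :
  polytime_poly N p -> polytime_poly N q ->
  polytime_poly N (fun e => division_step (p e) (q e)).
Proof.
move=> pp pq; split=> [e|i].
  exact: leq_trans (size_division_step_le _ _) (pp.1 e).
apply: polytime_rat_ext (fun e => esym (coef_division_step (p e) (q e) i)) _.
have psp := polytime_poly_size pp; have psq := polytime_poly_size pq.
apply: polytime_rat_if.
- by apply: polytime_leq; polytime.
- exact: pp.2.
- apply: polytime_rat_sub; first exact: pp.2.
  apply: polytime_rat_mul.
    apply: polytime_rat_mul; first exact: polytime_lead_coef pp.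
    by apply: polytime_rat_inv; exact: polytime_lead_coef pq.
  apply: (polytime_rat_case (N := N)
    (g := fun k e => if (i < k)%N then 0 else (q e)`_(i - k))
    (s := fun e => (size (p e) - size (q e))%N)).
  + by polytime.
  + by move=> e; apply: leq_trans (leq_subr _ _) (pp.1 e).
  + by move=> k; case: (i < k)%N; [exact: polytime_rat_const | exact: pq.2].
Qed.

Lemma polytime_poly_if N (b : E -> bool) p q :
  polytime b -> polytime_poly N p -> polytime_poly N q ->
  polytime_poly N (fun e => if b e then p e else q e).
Proof.
move=> pb [szp pp] [szq pq]; split=> [e|i]; first by case: (b e).
apply: (polytime_rat_ext (g := fun e => if b e then (p e)`_i else (q e)`_i)).
  by move=> e; case: (b e).
exact: polytime_rat_if.
Qed.

Lemma polytime_poly_const N (r : {poly rat}) :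
  (size r <= N)%N -> polytime_poly N (fun _ : E => r).
Proof. by move=> szr; split=> // i; exact: polytime_rat_const. Qed.

Lemma polytime_modp N p q :
  polytime_poly N p -> polytime_poly N q ->
  polytime_poly N (fun e => p e %% q e).
Proof.
move=> pp pq; apply: (polytime_poly_ext (g := fun e =>
  if q e == 0 then p e else iter N (division_step^~ (q e)) (p e))).
  move=> e; case: eqP => [->|/eqP q0]; first by rewrite modp0.
  exact: iter_division_step (pp.1 e).
apply: polytime_poly_if => //; first exact: polytime_poly_eq0 pq.
have piter n : polytime_poly N (fun e => iter n (division_step^~ (q e)) (p e)).
  elim: n => [|n IH]; first exact: pp.
  exact: (polytime_division_step
    (p := fun e => iter n (division_step^~ (q e)) (p e))).
exact: piter.
Qed.

Notation real_poly := (map_poly (ratr : rat -> R)).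

(** The crossing number compares the signs at both ends of the line. *)
Lemma crossR_real (r : {poly rat}) :
  (crossR (real_poly r))%:~R = if odd (size r) then 0 else Num.sg (lead_coef r).
Proof.
rewrite /crossR /variation /sgp_minfty /sgp_pinfty.
rewrite size_map_poly lead_coef_map.
have [->|r0] := eqVneq r 0.
  by rewrite size_poly0 lead_coef0 rmorph0 mulr0 sgr0 sgz0 mul0r.
have -> : odd (size r) = ~~ odd (size r).-1.
  by rewrite -oddS prednK ?size_poly_gt0.
rewrite -[(-1) ^+ _]signr_odd; case: (odd _) => /=.
  rewrite expr1 mulN1r -sgrM sgr_lt0 mulNr oppr_lt0 -expr2 exprn_even_gt0 //.
  rewrite fmorph_eq0 lead_coef_eq0 r0 mulr1 -ratr_sg.
  by case: sgrP; rewrite ?rmorph0 ?rmorph1 ?rmorphN1 ?sgz0 ?sgz1 ?sgzN1.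
by rewrite expr0 mul1r ltNge -expr2 sqr_ge0 mulr0.
Qed.

(** The recursion is on the degree of the second polynomial, which drops at
    each division and is bounded by a constant. *)
Lemma polytime_cindexR N p q :
  polytime_poly N p -> polytime_poly N q ->
  polytime_rat (fun e =>
    (cindexR (real_poly (q e)) (real_poly (p e)))%:~R).
Proof.
move=> pp pq; have [n le_q] : exists n, forall e, (size (q e) <= n)%N.
  by exists N; case: pq.
elim: n p q pp pq le_q => [|n IH] p q pp pq le_q.
  apply: polytime_rat_ext (polytime_rat_const 0) => e.
  move: (le_q e); rewrite leqn0 size_poly_eq0 => /eqP ->.
  by rewrite rmorph0 cindexR0p.
pose r e := if q e == 0 then 0 else p e %% q e.
have pr : polytime_poly N r.
  apply: polytime_poly_if; first exact: polytime_poly_eq0 pq.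
    by apply: polytime_poly_const; rewrite size_poly0.
  exact: polytime_modp.
apply: (polytime_rat_ext (g := fun e =>
  (if odd (size (p e * q e)) then 0 else Num.sg (lead_coef (p e * q e)))
  - (cindexR (real_poly (r e)) (real_poly (q e)))%:~R)).
  move=> e; rewrite [in RHS]cindexR_modp -map_modp -rmorphM rmorphB /= crossR_real.
  congr (_ - _%:~R); rewrite /r; case: eqP => [->|//].
  by rewrite !rmorph0 /cindexR rootsR0 !big_nil.
have ppq := polytime_poly_mul pp pq.
apply: polytime_rat_sub.
  apply: polytime_rat_if; last first.
  - by apply: polytime_rat_sg; exact: polytime_lead_coef ppq.
  - exact: polytime_rat_const.
  - by apply: polytime_odd; exact: polytime_poly_size ppq.
apply: IH => // e; rewrite /r; case: eqP => [_|/eqP q0].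
  by rewrite size_poly0.
by rewrite -ltnS; apply: leq_trans (le_q e); rewrite ltn_modp.
Qed.

Lemma polytime_nonnegative N g : polytime_poly N g ->
  exists2 b : E -> bool, polytime b &
    forall e, b e <-> forall x : R, 0 <= (real_poly (g e)).[x].
Proof.
move=> pg; have pg' := polytime_poly_deriv pg.
have pg'' := polytime_poly_deriv pg'.
pose c1 e : rat := (cindexR (real_poly ((g e)^`()^`() * (g e * g e)))
                    (real_poly (g e)^`()))%:~R.
pose c2 e : rat := (cindexR (real_poly ((g e)^`()^`() * g e))
                    (real_poly (g e)^`()))%:~R.
exists (fun e => (g e == 0) || [&& ~~ (0 <= - lead_coef (g e)),
  odd (size (g e)) & c1 e == c2 e]).
  apply: polytime_or; first exact: polytime_poly_eq0 pg.
  apply: polytime_and.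
    apply: polytime_neg; apply: polytime_rat_ge0; apply: polytime_rat_opp.
    exact: polytime_lead_coef pg.
  apply: polytime_and; first by apply: polytime_odd; exact: polytime_poly_size pg.
  have pw M h : (N <= M)%N -> polytime_poly N h -> polytime_poly M h.
    move=> le_M ph.
    exact: (polytime_poly_widen (fun e => leq_trans (ph.1 e) le_M) ph).
  apply: polytime_rat_eq.
    apply: (polytime_cindexR (N := N + (N + N))).
      by apply: pw pg'; lia.
    exact: polytime_poly_mul pg'' (polytime_poly_mul pg pg).
  apply: (polytime_cindexR (N := N + N)); first by apply: pw pg'; lia.
  exact: polytime_poly_mul pg'' pg.
move=> e; rewrite nonnegativeP !deriv_map -!rmorphM /c1 /c2.
rewrite map_poly_eq0 lead_coef_map size_map_poly ltr0q oppr_ge0 -ltNge.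
by rewrite eqr_int.
Qed.

End SturmPolytime.

(** * Reading the list of coefficients *)

Section Parsing.
Local Open Scope nat_scope.

(** The phase says which bit comes next: the sign (0), a mark (1) or a digit
    (2) of the numerator, a mark (3) or a digit (4) of the denominator; then
    come the sign, the digits read so far and the fractions read so far, both
    in reverse order. *)
Notation parser := (nat * bool * natural * natural * seq fraction)%type.

Definition read_fraction (s : bool) (u v : natural) : fraction :=
  (if s then ([::], rev u) else (rev u, [::]), (rev v, [::])).

Definition parse_step (st : parser) (b : bool) : parser :=
  let: (k, s, u, v, out) := st in
  if k == 0 then (1, b, u, v, out) else
  if k == 1 then (if b then 2 else 3, s, u, v, out) else
  if k == 2 then (1, s, b :: u, v, out) else
  if k == 3 then
    if b then (4, s, u, v, out)
    else (0, s, [::], [::], read_fraction s u v :: out)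
  else (3, s, u, b :: v, out).

Definition parse (w : seq bool) : seq fraction :=
  rev (foldl parse_step (0, false, [::], [::], [::]) w).2.

Lemma parse_digits_num a s u v out w :
  foldl parse_step (1, s, u, v, out)
    (flatten [seq [:: true; b] | b <- a] ++ false :: w) =
  foldl parse_step (3, s, catrev a u, v, out) w.
Proof. by elim: a u => //= b a IH u; rewrite IH. Qed.

Lemma parse_digits_den a s u v out w :
  foldl parse_step (3, s, u, v, out)
    (flatten [seq [:: true; b] | b <- a] ++ false :: w) =
  foldl parse_step (0, s, [::], [::], read_fraction s u (catrev a v) :: out) w.
Proof. by elim: a v => //= b a IH v; rewrite IH. Qed.

Lemma parse_rat q s out w :
  foldl parse_step (0, s, [::], [::], out) (encode_rat q ++ w) =
  foldl parse_step ((0, (q < 0)%R, [::], [::], frac_of q :: out)) w.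
Proof.
rewrite /encode_rat /encode_nat /frac_of.
move: (bits `|numq q|%N) (bits `|denq q|%N) => a b.
rewrite cat_cons -!catA !cat1s [foldl _ _ _]/=.
by rewrite parse_digits_num parse_digits_den /read_fraction !revK.
Qed.

Lemma parse_encode qs : parse (flatten (map encode_rat qs)) = map frac_of qs.
Proof.
rewrite /parse; set st := (_, _, _, _, _).
suff h s out : rev (foldl parse_step (0, s, [::], [::], out)
    (flatten (map encode_rat qs))).2 = rev out ++ map frac_of qs.
  by rewrite h.
elim: qs s out => [|q qs IH] s out; first by rewrite cats0.
rewrite -[flatten _]/(encode_rat q ++ flatten (map encode_rat qs)).
by rewrite parse_rat IH rev_cons cat_rcons.
Qed.

Lemma bits_of_rev A (eA : encoding A) (s : seq A) : bits_of (rev s) = bits_of s.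
Proof.
rewrite -[rev s]/(catrev s [::]).
have h t : (bits_of (catrev s t)).+1 = bits_of s + bits_of t.
  elim: s t => [|x s IH] t; first by rewrite bits_of_nil.
  by rewrite [catrev _ _]/(catrev s (x :: t)) IH !bits_of_cons; lia.
by apply/eqP; rewrite -eqSS h bits_of_nil addn1.
Qed.

Lemma polytime_parse : polytime parse.
Proof.
apply: (polytime_ext (f := fun w =>
  rev (foldl parse_step (0, false, [::], [::], [::]) w).2)) => //.
apply: (polytime_rev (([::], [::]), ([::], [::]))).
apply: polytime_snd_of.
apply: (polytime_foldl_grow (f := fun _ : seq bool => parse_step) false
  (G := fun n => n + 100)).
- apply: (polytime_ext (f := fun x : seq bool * parser * bool =>
    let st := x.1.2 in let b := x.2 in
    let k := st.1.1.1.1 in let s := st.1.1.1.2 in let u := st.1.1.2 in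
    let v := st.1.2 in let out := st.2 in
    if k == 0 then (1, b, u, v, out) else
    if k == 1 then (if b then 2 else 3, s, u, v, out) else
    if k == 2 then (1, s, b :: u, v, out) else
    if k == 3 then
      if b then (4, s, u, v, out)
      else (0, s, [::], [::], read_fraction s u v :: out)
    else (3, s, u, b :: v, out))).
    by move=> [[e [[[[k s] u] v] out]] b].
  have prev E (eE : encoding E) (f : E -> natural) :
      polytime f -> polytime (fun e => rev (f e)).
    exact: (polytime_rev false).
  rewrite /= /read_fraction.
  by apply: polytime_if; [polytime|polytime|];
     apply: polytime_if; [polytime|polytime|];
     apply: polytime_if; [polytime|polytime|];
     apply: polytime_if; [polytime| |polytime];
     apply: polytime_if; [polytime|polytime|]; polytime.
- by polytime.
- by polytime.
- by poly_bound.
- move=> e [[[[k s] u] v] out] b.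
  have szb := bits_of_bool b; have szs := bits_of_bool s.
  have b0 := bits_of_gt0 encoding_bool b.
  have s0 := bits_of_gt0 encoding_bool s.
  rewrite /parse_step /read_fraction; case: k => [|[|[|[|k]]]] /=;
  rewrite ?(fun_if bits_of); case: b szb b0 => szb b0;
  rewrite !(bits_of_pair, bits_of_cons, bits_of_nil, bits_of_nat);
  try case: s szs s0 => szs s0;
  rewrite ?(bits_of_pair, bits_of_rev, bits_of_nil); lia.
Qed.

End Parsing.

(** * Restriction of a polynomial to a line *)

Section Lines.
Context {R : realFieldType} {n : nat}.
Implicit Types (f g : {mpoly R[n]}) (x v : 'I_n -> R).

Definition line f x v : {poly R} :=
  mmap polyC (fun i => (x i)%:P + v i *: 'X) f.

Lemma lineD f g x v : line (f + g) x v = line f x v + line g x v.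
Proof. exact: mmapD. Qed.

Lemma lineM f g x v : line (f * g) x v = line f x v * line g x v.
Proof. exact: rmorphM. Qed.

Lemma lineC c x v : line c%:MP x v = c%:P.
Proof. exact: mmapC. Qed.

Lemma lineZ c f x v : line (c *: f) x v = c *: line f x v.
Proof. by rewrite -mul_mpolyC lineM lineC mul_polyC. Qed.

Lemma line_sum (I : Type) (r : seq I) (P : pred I) (F : I -> {mpoly R[n]}) x v :
  line (\sum_(i <- r | P i) F i) x v = \sum_(i <- r | P i) line (F i) x v.
Proof. exact: raddf_sum. Qed.

Lemma lineX i x v : line 'X_i x v = (x i)%:P + v i *: 'X.
Proof. by rewrite /line mmapX mmap1U. Qed.

Lemma mpoly_ring_ind (P : {mpoly R[n]} -> Prop) :
  (forall c, P c%:MP) -> (forall i, P 'X_i) ->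
  (forall f g, P f -> P g -> P (f + g)) ->
  (forall f g, P f -> P g -> P (f * g)) -> forall f, P f.
Proof.
move=> PC PX PD PM f; rewrite [f]mpolyE.
have P0 : P 0 by rewrite -mpolyC0.
elim/big_ind: _ => // m _; rewrite -mul_mpolyC; apply: (PM _ _ (PC _)).
rewrite mpolyXE_id; elim/big_ind: _ => // [|i _].
  by rewrite -mpolyC1.
elim: (m i) => [|k IH]; first by rewrite expr0 -mpolyC1.
by rewrite exprS; apply: PM.
Qed.

Lemma horner_line f x v t : (line f x v).[t] = f.@[fun i => x i + t * v i].
Proof.
elim/mpoly_ring_ind: f => [c|i|f g IHf IHg|f g IHf IHg].
- by rewrite lineC hornerC mevalC.
- by rewrite lineX mevalXU !hornerE mulrC.
- by rewrite lineD hornerD IHf IHg mevalD.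
- by rewrite lineM hornerM IHf IHg mevalM.
Qed.

Lemma horner_line0 f x v : (line f x v).[0] = f.@[x].
Proof. by rewrite horner_line; apply: meval_eq => i; rewrite mul0r addr0. Qed.

Lemma deriv_line f x v :
  (line f x v)^`() = \sum_i v i *: line (f^`M(i)) x v.
Proof.
elim/mpoly_ring_ind: f => [c|i|f g IHf IHg|f g IHf IHg].
- rewrite lineC derivC big1 // => i _.
  by rewrite mderivC -mpolyC0 lineC polyC0 scaler0.
- rewrite lineX !derivE add0r (bigD1 i) //= mderivX mnm1E eqxx.
  have -> : (U_(i) - U_(i))%MM = 0%MM :> 'X_{1..n}.
    by apply/mnmP => k; rewrite mnmBE mnm0E subnn.
  rewrite mpolyX0 scale1r -mpolyC1 lineC.
  rewrite big1 ?addr0 ?alg_polyC // => j ne_j; rewrite mderivX mnm1E.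
  by rewrite eq_sym (negPf ne_j) scale0r -mpolyC0 lineC polyC0 scaler0.
- rewrite lineD derivD IHf IHg -big_split; apply: eq_bigr => i _ /=.
  by rewrite mderivD lineD scalerDr.
- rewrite lineM derivM IHf IHg big_distrl big_distrr -big_split /=.
  apply: eq_bigr => i _; rewrite mderivM lineD !lineM scalerDr.
  by rewrite -scalerAl -scalerAr.
Qed.

Definition top_form (d : nat) f : {mpoly R[n]} := pihomog mdeg d f.

Lemma line_monomial m x v :
  (size (line 'X_[m] x v) <= (mdeg m).+1)%N /\
  (line 'X_[m] x v)`_(mdeg m) = 'X_[m].@[v].
Proof.
pose ok (p : {poly R}) (k : nat) c := (size p <= k.+1)%N /\ p`_k = c.
have ok1 : ok 1 0%N 1 by rewrite /ok size_poly1 coef1.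
have okM p k c q l e : ok p k c -> ok q l e -> ok (p * q) (k + l)%N (c * e).
  move=> [szp cp] [szq cq]; split.
    apply: leq_trans (size_polyMleq _ _) _; move: szp szq.
    by move: (size p) (size q) => a b; lia.
  rewrite coefM (bigD1 (inord k)) //= inordK ?leq_addr // addKn cp cq.
  rewrite big1 ?addr0 // => i ne_i.
  have [lt_ik|le_ki] := ltnP i k.
    rewrite [q`_ _]nth_default ?mulr0 //; apply: leq_trans szq _.
    by have := ltn_ord i; lia.
  rewrite [p`_ _]nth_default ?mul0r //; apply: leq_trans szp _.
  rewrite ltn_neqAle le_ki andbT; apply: contra ne_i => /eqP eq_ki.
  by apply/eqP/val_inj; rewrite /= inordK ?leq_addr.
rewrite mevalX mpolyXE_id mdegE /line rmorph_prod /=.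
apply: (big_rec3 ok) => // i k c p _ okp; apply: (okM _ _ _ _ _ _ _ okp).
rewrite rmorphXn /= mmapX mmap1U.
elim: (m i) => [|j IH]; first by rewrite !expr0.
rewrite !exprS -[j.+1]add1n; apply: okM => //; split.
  apply: leq_trans (size_polyD _ _) _; rewrite geq_max.
  apply/andP; split; first by apply: leq_trans (size_polyC_leq1 _) _.
  by apply: leq_trans (size_scale_leq _ _) _; rewrite size_polyX.
by rewrite coefD coefC coefZ coefX add0r mulr1.
Qed.

Lemma size_line d f x v : (msize f <= d.+1)%N -> (size (line f x v) <= d.+1)%N.
Proof.
move=> szf; rewrite [f]mpolyE line_sum big_seq.
elim/big_ind: _ => [|p q szp szq|m hm]; first by rewrite size_poly0.
  by apply: leq_trans (size_polyD _ _) _; rewrite geq_max szp.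
rewrite lineZ; apply: leq_trans (size_scale_leq _ _) _.
apply: leq_trans (line_monomial m x v).1 _; rewrite ltnS.
by rewrite -ltnS; apply: leq_trans (msize_mdeg_lt hm) szf.
Qed.

(** The top coefficient on a line depends on the direction alone: base points
    only contribute to lower powers of the parameter. *)
Lemma coef_line_top d f x v :
  (msize f <= d.+1)%N -> (line f x v)`_d = (top_form d f).@[v].
Proof.
move=> szf; rewrite /top_form pihomogE {1}[f]mpolyE line_sum coef_sum.
rewrite raddf_sum [RHS]big_mkcond /= big_seq [RHS]big_seq.
apply: eq_bigr => m hm; rewrite lineZ coefZ mevalZ.
have [szm cm] := line_monomial m x v.
case: eqP => [<-|/eqP ne_d]; first by rewrite cm.
rewrite nth_default ?mulr0 //; apply: leq_trans szm _.
rewrite ltn_neqAle ne_d -ltnS; exact: leq_trans (msize_mdeg_lt hm) szf.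
Qed.

Lemma top_form_neq0 d f : msize f = d.+1 -> top_form d f != 0.
Proof.
move=> szf; have f0 : f != 0 by rewrite -msize_poly_eq0 szf.
have : (top_form d f)@_(mlead f) != 0.
  rewrite /top_form pihomogE raddf_sum /=.
  have dl : mdeg (mlead f) == d by rewrite -eqSS mlead_deg // szf.
  rewrite -big_filter (bigD1_seq (mlead f)) /=; last first.
  - by rewrite filter_uniq ?msupp_uniq.
  - by rewrite mem_filter dl mlead_supp.
  rewrite big1 => [|m ne_m].
    by rewrite addr0 mcoeffZ mcoeffX eqxx mulr1 mleadc_eq0.
  by rewrite mcoeffZ mcoeffX (negPf ne_m) mulr0.
by apply: contraNneq => ->; rewrite mcoeff0.
Qed.

End Lines.

(** * Polynomials vanishing everywhere *)

Section Vanishing.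
Context {R : rcfType}.

Lemma poly_vanishing (p : {poly R}) : (forall t, p.[t] = 0) -> p = 0.
Proof.
move=> p0; apply/eqP; apply: contraT => nz.
have := ge_cauchy_bound nz (_ : cauchy_bound p \in _).
by rewrite in_itv /= lexx rootE p0 eqxx => /(_ isT).
Qed.

Lemma mnm_neq0 n (m : 'X_{1..n}) : m != 0%MM -> exists i, m i != 0%N.
Proof.
move=> m0; apply/existsP; apply: contraNT m0; rewrite negb_exists => /forallP mz.
by apply/eqP/mnmP => i; rewrite mnm0E; apply/eqP; rewrite -[_ == _]negbK.
Qed.

Lemma meval_zero n (f : {mpoly R[n]}) : f.@[fun=> 0] = f@_0%MM.
Proof.
elim/(@mpoly_ring_ind R n): f => [c|i|f g IHf IHg|f g IHf IHg].
- by rewrite mevalC mcoeffC eqxx mulr1.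
- by rewrite mevalXU mcoeffX mnm1_eq0.
- by rewrite mevalD IHf IHg mcoeffD.
- by rewrite mevalM IHf IHg rmorphM.
Qed.

(** The derivatives of a vanishing function vanish, so the coefficients are
    zero by induction on the degree of the monomial. *)
Lemma mpoly_vanishing n (f : {mpoly R[n]}) : (forall x, f.@[x] = 0) -> f = 0.
Proof.
move=> f0; apply/mpolyP => m; rewrite mcoeff0.
have [k] := ubnP (mdeg m); elim: k m f f0 => // k IH m f f0 lt_m.
have [->|/mnm_neq0[i mi]] := eqVneq m 0%MM; first by rewrite -meval_zero f0.
have le_i : (U_(i) <= m)%MM by rewrite lep1mP.
have f'0 x : f^`M(i).@[x] = 0.
  have l0 : line f x (fun j => (j == i)%:R) = 0.
    by apply: poly_vanishing => t; rewrite horner_line f0.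
  have := deriv_line f x (fun j => (j == i)%:R).
  rewrite l0 derivC (bigD1 i) //= eqxx scale1r big1 ?addr0 => [|j ne_j].
    by move=> l'0; rewrite -(horner_line0 _ x (fun j => (j == i)%:R)) -l'0 horner0.
  by rewrite (negPf ne_j) scale0r.
have := IH (m - U_(i))%MM _ f'0; rewrite mcoeff_mderiv submK //.
have -> : (mdeg (m - U_(i)) < k)%N.
  by move: lt_m; rewrite -{1}(submK le_i) mdegD mdeg1 addn1.
by move=> /(_ isT)/eqP; rewrite mulrn_eq0 /= => /eqP.
Qed.

End Vanishing.

(** * Univariate polynomials along lines *)

Section Univariate.
Context {R : rcfType}.
Implicit Types p q : {poly R}.

(** By continuity: near any point there are points where [q] is not zero. *)
Lemma poly_ge0_off_roots p q :
  q != 0 -> (forall t, 0 <= p.[t] * q.[t] ^+ 2) -> forall t, 0 <= p.[t].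
Proof.
move=> q0 pq t; rewrite leNgt; apply/negP => pt.
have [|e e0 he] := @poly_cont _ t p (- p.[t]); first by rewrite oppr_gt0.
have [|y yI] := @neighpr_wit _ q t (t + e) _ q0; first by rewrite ltrDl.
have ry := neighpr_root yI.
have lt_ty : t < y by rewrite (itvP yI).
have lt_y : y < t + e.
  have := next_root_in q t (t + e).
  rewrite in_itv /= => /andP[_]; rewrite max_l ?lerDl ?(ltW e0) // => le_n.
  by apply: lt_le_trans le_n; rewrite (itvP yI).
have py : p.[y] < 0.
  have := he y; rewrite ger0_norm; last by rewrite subr_ge0 ltW.
  rewrite ltrBlDl => /(_ lt_y)/ltr_normlP[_].
  by rewrite ltrBlDr addNr.
have := pq y; rewrite leNgt pmulr_llt0 ?py // exprn_even_gt0 //=.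
Qed.

(** Were the derivative negative at [t], [q] would have a smaller value to the
    right of [t] and also to the left, as it tends to minus infinity there. *)
Lemma quasiconvex_poly_deriv q :
  0 < lead_coef q -> ~~ odd (size q) ->
  (forall s t u, s < t -> t < u -> q.[t] <= Num.max q.[s] q.[u]) ->
  forall t, 0 <= q^`().[t].
Proof.
move=> lq evq qc t; rewrite leNgt; apply/negP => q't.
have [|e e0 he] := @poly_cont _ t q^`() (- q^`().[t]); first by rewrite oppr_gt0.
pose u := t + e / 2.
have e20 : 0 < e / 2 by rewrite divr_gt0.
have tu : t < u by rewrite /u ltrDl.
have qu : q.[u] < q.[t].
  have [c cI] := poly_mvt q tu.
  suff q'c : q^`().[c] < 0.
    by rewrite -subr_lt0 => ->; rewrite nmulr_rlt0 // subr_gt0.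
  have tc : t < c by rewrite (itvP cI).
  have cu : c < t + e.
    apply: (@lt_trans _ _ u); first by rewrite (itvP cI).
    by rewrite /u ltrD2l ltr_pdivrMr // ltr_pMr // ltr1n.
  have := he c; rewrite ger0_norm; last by rewrite subr_ge0 ltW.
  rewrite ltrBlDl => /(_ cu)/ltr_normlP[_].
  by rewrite ltrBlDr addNr.
have szq : (1 < size q)%N.
  have : (0 < size q)%N by rewrite size_poly_gt0 -lead_coef_eq0 gt_eqF.
  by move: evq; case: (size q) => [|[|k]].
pose r := q - q.[t]%:P.
have szC : (size (- q.[t]%:P)%R < size q)%N.
  by rewrite size_polyN; apply: leq_ltn_trans (size_polyC_leq1 _) szq.
have r0 : r != 0 by rewrite -size_poly_gt0 /r size_polyDl // ltnW.
have minf : sgp_minfty r = -1.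
  rewrite /sgp_minfty /r size_polyDl // lead_coefDl // -signr_odd.
  have -> : odd (size q).-1 = true.
    by move: evq; rewrite -[in odd (size q)](prednK (ltnW szq)) /= negbK.
  by rewrite expr1 mulN1r sgrN gtr0_sg.
(* Beyond the Cauchy bound, [r] has its sign at minus infinity. *)
pose s := Num.min (- cauchy_bound r) (t - 1).
have st : s < t by rewrite /s gt_min ltrBlDr ltrDl ltr01 orbT.
have qs : q.[s] < q.[t].
  have : Num.sg r.[s] = -1.
    rewrite (sgp_minftyP (le_cauchy_bound r0)) ?minf //.
    by rewrite in_itv /= /s ge_min lexx.
  by move/eqP; rewrite sgr_cp0 /r hornerD hornerN hornerC subr_lt0.
have := qc s t u st tu.
by rewrite le_max leNgt qs leNgt qu.
Qed.

Lemma monotone_poly_segment q t :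
  (forall s, 0 <= q^`().[s]) \/ (forall s, q^`().[s] <= 0) ->
  0 <= t <= 1 -> q.[t] <= Num.max q.[0] q.[1].
Proof.
move=> hq /andP[t0 t1]; rewrite le_max.
case: hq => hq; apply/orP; [right | left].
  by apply: (@ler_hornerW _ 0 1 q) => //; rewrite in_itv /= ?t0 ?t1 ?ler01 ?lexx.
rewrite -lerN2 -!hornerN.
apply: (@ler_hornerW _ 0 1 (- q)) => [s _|||//]; rewrite ?in_itv /= ?t0 ?ler01 ?lexx //.
by rewrite derivN hornerN oppr_ge0.
Qed.

End Univariate.

(** * Quasiconvex polynomials of odd degree *)

Section Criterion.
Context {R : realType} {n : nat}.
Implicit Types (f : {mpoly R[n]}) (x y v w : 'I_n -> R).

Definition row_function f : 'rV[R]_n -> R := fun z => f.@[fun i => z 0 i].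

Lemma quasiconvex_segments f :
  quasiconvex (row_function f) <->
  forall x v t, 0 <= t <= 1 ->
    (line f x v).[t] <= Num.max (line f x v).[0] (line f x v).[1].
Proof.
split=> [qc x v t /andP[t0 t1]|seg alpha].
  set M := Num.max _ _.
  pose a : 'rV[R]_n := \row_i (x i + v i); pose b : 'rV[R]_n := \row_i x i.
  have fa : row_function f a = (line f x v).[1].
    by rewrite horner_line; apply: meval_eq => i; rewrite mxE mul1r.
  have fb : row_function f b = (line f x v).[0].
    by rewrite horner_line; apply: meval_eq => i; rewrite mxE mul0r addr0.
  have := qc M a b (Itv01 t0 t1); rewrite !inE /= fa fb => h.
  have aM : (line f x v).[1] <= M by rewrite le_max lexx orbT.
  have bM : (line f x v).[0] <= M by rewrite le_max lexx.
  apply: le_trans (h aM bM); rewrite le_eqVlt; apply/orP; left; apply/eqP.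
  rewrite horner_line; apply: meval_eq => i.
  by rewrite !mxE /onem /=; ring.
move=> x y l; rewrite !inE /= => fx fy.
have := seg (fun i => y 0 i) (fun i => x 0 i - y 0 i) l%:num.
have -> : 0 <= l%:num <= 1 by apply/andP; split; [exact: ge0|exact: le1].
move=> /(_ isT); rewrite !horner_line => h.
have eq1 : f.@[fun i => y 0 i + 0 * (x 0 i - y 0 i)] = row_function f y.
  by apply: meval_eq => i; rewrite mul0r addr0.
have eq2 : f.@[fun i => y 0 i + 1 * (x 0 i - y 0 i)] = row_function f x.
  by apply: meval_eq => i; rewrite mul1r addrC subrK.
move: h; rewrite eq1 eq2 => h.
apply: le_trans (_ : Num.max (row_function f y) (row_function f x) <= _).
  apply: le_trans h; rewrite le_eqVlt; apply/orP; left; apply/eqP.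
  by apply: meval_eq => i; rewrite !mxE /onem /=; ring.
by rewrite ge_max fx fy.
Qed.

Definition slope f x v : R := \sum_i v i * (f^`M(i)).@[x].

Lemma deriv_line_slope f x v t :
  (line f x v)^`().[t] = slope f (fun i => x i + t * v i) v.
Proof.
rewrite deriv_line horner_sum; apply: eq_bigr => i _.
by rewrite hornerZ horner_line.
Qed.

Section OddDegree.
Variables (d : nat) (f : {mpoly R[n]}).
Hypotheses (odd_d : odd d) (szf : msize f = d.+1).

Let top v : R := (top_form d f).@[v].

(** The leading form is odd: this is where the parity of the degree enters. *)
Let topN v : top (fun i => - v i) = - top v.
Proof.
have topE u : top u =
    \sum_(m <- msupp f | mdeg m == d) f@_m * \prod_i u i ^+ m i.
  rewrite /top /top_form pihomogE raddf_sum; apply: eq_bigr => m _ /=.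
  by rewrite mevalZ mevalX.
rewrite !topE -sumrN; apply: eq_bigr => m /eqP dm; rewrite -mulrN.
congr (_ * _).
transitivity (\prod_i ((-1) ^+ m i * v i ^+ m i)).
  by apply: eq_bigr => i _; rewrite -exprMn mulN1r.
by rewrite big_split /= prodrXr -mdegE dm -signr_odd odd_d expr1 mulN1r.
Qed.

Hypothesis qc : quasiconvex (row_function f).

(** Along a direction in which the leading form is positive, [f] is a
    quasiconvex polynomial of odd degree, hence is nondecreasing. *)
Lemma slope_ge0 x v : 0 < top v -> 0 <= slope f x v.
Proof.
move=> topv; have cd : (line f x v)`_d = top v by rewrite coef_line_top ?szf.
have szq : size (line f x v) = d.+1.
  apply/eqP; rewrite eqn_leq size_line ?szf // ltnNge; apply/negP => le_d.
  by move: topv; rewrite -cd nth_default ?ltxx.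
have -> : slope f x v = (line f x v)^`().[0].
  rewrite deriv_line_slope; apply: eq_bigr => i _; congr (_ * _).
  by apply: meval_eq => j; rewrite mul0r addr0.
apply: quasiconvex_poly_deriv => [||s t u st tu].
- by rewrite lead_coefE szq cd.
- by rewrite szq /= odd_d.
- have su0 : 0 < u - s by rewrite subr_gt0 (lt_trans st).
  have := (quasiconvex_segments f).1 qc (fun i => x i + s * v i)
    (fun i => (u - s) * v i) ((t - s) / (u - s)).
  have -> : 0 <= (t - s) / (u - s) <= 1.
    rewrite ler_pdivrMr // mul1r lerD2r (ltW tu) andbT.
    by rewrite divr_ge0 ?subr_ge0 ?(ltW st) ?(ltW (lt_trans st tu)).
  move=> /(_ isT); rewrite !horner_line.
  have ev r c : c = s + r * (u - s) ->
      f.@[fun i => x i + s * v i + r * ((u - s) * v i)] =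
      f.@[fun i => x i + c * v i].
    by move=> ->; apply: meval_eq => i; ring.
  rewrite (ev _ t) ?divfK ?gt_eqF //; last by rewrite addrC subrK.
  by rewrite (ev 0 s) ?mul0r ?addr0 // (ev 1 u) // mul1r addrC subrK.
Qed.

Lemma slope_top_ge0 x v : 0 <= slope f x v * top v.
Proof.
have [topv|topv|<-] := ltgtP 0 (top v); last by rewrite mulr0.
  by rewrite mulr_ge0 ?slope_ge0 // ltW.
have := @slope_ge0 x (fun i => - v i); rewrite topN oppr_gt0 => /(_ topv) h.
have sN : slope f x (fun i => - v i) = - slope f x v.
  by rewrite /slope -sumrN; apply: eq_bigr => i _; rewrite mulNr.
rewrite -mulrNN; apply: mulr_ge0; first by rewrite -sN.
by rewrite oppr_ge0 ltW.
Qed.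

(** Where the leading form is not zero, no slope has the opposite sign. These
    directions are dense: the leading form is a nonzero polynomial on a line
    from [w] to [v]. *)
Lemma slopes_same_sign x y v : 0 <= slope f x v * slope f y v.
Proof.
have [w topw] : exists w, top w != 0.
  apply: contrapT => no; have /eqP := top_form_neq0 szf; apply.
  by apply: mpoly_vanishing => w; apply/eqP;
     apply: contrapT => /negP ?; apply: no; exists w.
pose z t i := w i + t * (v i - w i).
pose P x' : {poly R} :=
  \sum_i (f^`M(i)).@[x'] *: ((w i)%:P + (v i - w i) *: 'X).
have PE x' t : (P x').[t] = slope f x' (z t).
  rewrite /P horner_sum; apply: eq_bigr => i _.
  by rewrite !hornerE mulrC [_ * t]mulrC.
pose q := line (top_form d f) w (fun i => v i - w i).
have qE t : q.[t] = top (z t) by rewrite /q horner_line.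
have q0 : q != 0.
  apply: contraNneq topw => q0; have := qE 0; rewrite q0 horner0 => ->.
  by apply/eqP; apply: meval_eq => i; rewrite /z mul0r addr0.
have := @poly_ge0_off_roots _ (P x * P y) q q0 _ 1.
rewrite hornerM !PE.
have z1 x' : slope f x' (z 1) = slope f x' v.
  by apply: eq_bigr => i _; rewrite /z mul1r addrC subrK.
rewrite !z1; apply=> t; rewrite hornerM !PE qE expr2 mulrACA.
by apply: mulr_ge0; exact: slope_top_ge0.
Qed.

(** If two planar vectors are not parallel, some [v] has a positive product
    with one and a negative product with the other. *)
Lemma gradients_parallel x y i j :
  (f^`M(i)).@[x] * (f^`M(j)).@[y] = (f^`M(j)).@[x] * (f^`M(i)).@[y].
Proof.
have [->//|ne_ij] := eqVneq i j.
set ai := _.@[x]; set bj := (f^`M(j)).@[y]; set aj := _.@[x]; set bi := _.@[y].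
(* The normal to the sum of the two vectors: its products with them are
   opposite, equal to plus and minus the determinant. *)
pose v k := if k == i then bj + aj else if k == j then - bi - ai else 0.
have sE x' : slope f x' v =
    (bj + aj) * (f^`M(i)).@[x'] + (- bi - ai) * (f^`M(j)).@[x'].
  rewrite /slope (bigD1 i) //= (bigD1 j) /=; last by rewrite eq_sym.
  rewrite /v eqxx [j == i]eq_sym (negPf ne_ij) eqxx big1 ?addr0 // => k.
  by case/andP=> /negPf -> /negPf ->; rewrite mul0r.
have := slopes_same_sign x y v; rewrite !sE -/ai -/aj -/bi -/bj => h.
have sq : (ai * bj - aj * bi) ^+ 2 <= 0.
  rewrite -oppr_ge0; apply: le_trans h _; rewrite le_eqVlt; apply/orP; left.
  by apply/eqP; ring.
by apply/eqP; rewrite -subr_eq0 -sqrf_eq0 eq_le sq sqr_ge0.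
Qed.

End OddDegree.

(** A bilinear identity between values passes to coefficients one variable at
    a time, by [mpoly_vanishing]. *)
Lemma mcoeff_parallel f :
  (forall x y i j,
     (f^`M(i)).@[x] * (f^`M(j)).@[y] = (f^`M(j)).@[x] * (f^`M(i)).@[y]) ->
  forall i j m m',
    (f^`M(i))@_m * (f^`M(j))@_m' = (f^`M(j))@_m * (f^`M(i))@_m'.
Proof.
move=> par i j m m'.
have h y : (f^`M(i))@_m * (f^`M(j)).@[y] = (f^`M(j))@_m * (f^`M(i)).@[y].
  have : (f^`M(j)).@[y] *: f^`M(i) - (f^`M(i)).@[y] *: f^`M(j) = 0.
    apply: mpoly_vanishing => x; rewrite mevalB !mevalZ.
    by rewrite mulrC par mulrC subrr.
  move/(congr1 (mcoeff m)); rewrite mcoeffB !mcoeffZ mcoeff0 => /eqP.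
  by rewrite subr_eq0 mulrC => /eqP ->; rewrite mulrC.
have : (f^`M(i))@_m *: f^`M(j) - (f^`M(j))@_m *: f^`M(i) = 0.
  by apply: mpoly_vanishing => y; rewrite mevalB !mevalZ h subrr.
move/(congr1 (mcoeff m')); rewrite mcoeffB !mcoeffZ mcoeff0 => /eqP.
by rewrite subr_eq0 => /eqP.
Qed.

Definition unit_vector (i : 'I_n) : 'I_n -> R := fun j => (j == i)%:R.

Definition axis_derivative f (i : 'I_n) : {poly R} :=
  line (f^`M(i)) (fun=> 0) (unit_vector i).

(** A polynomial whose gradients are multiples of [xi] is constant on the level
    sets of [xi], and each of these meets the [i]-th axis in one point. *)
Lemma proportional_gradient g (xi : 'I_n -> R) i :
  xi i = 1 -> (forall j, g^`M(j) = xi j *: g^`M(i)) ->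
  forall z, g.@[z] = (line g (fun=> 0) (unit_vector i)).[\sum_j xi j * z j].
Proof.
move=> xi1 par z; set c := \sum_j _.
pose w j := z j - c * unit_vector i j.
pose L := line g (fun j => c * unit_vector i j) w.
have L'0 : L^`() = 0.
  rewrite /L deriv_line.
  transitivity ((\sum_j w j * xi j) *:
      line g^`M(i) (fun j => c * unit_vector i j) w).
    by rewrite scaler_suml; apply: eq_bigr => j _; rewrite (par j) lineZ scalerA.
  suff -> : \sum_j w j * xi j = 0 by rewrite scale0r.
  rewrite /w; under eq_bigr do rewrite mulrBl.
  rewrite sumrB (eq_bigr (fun j => xi j * z j)) => [|j _]; last exact: mulrC.
  rewrite -/c [X in _ - X](bigD1 i) //= /unit_vector eqxx xi1 !mulr1.
  rewrite big1 ?addr0 ?subrr // => j /negPf ->.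
  by rewrite mulr0 mul0r.
have L01 : L.[1] = L.[0].
  have [s _] := poly_mvt L (ltr01 : (0 : R) < 1).
  by rewrite L'0 horner0 mul0r => /eqP; rewrite subr_eq0 => /eqP.
rewrite horner_line; transitivity L.[1].
  by rewrite horner_line; apply: meval_eq => j; rewrite /w; ring.
by rewrite L01 horner_line; apply: meval_eq => j; rewrite mul0r addr0 add0r.
Qed.

(** For the converse, a nonzero entry of the coefficient matrix serves as pivot:
    the gradients are multiples of its column [xi], and the sign of the [i]-th
    partial derivative is known everywhere once known on the [i]-th axis. *)
Theorem quasiconvex_criterion d f : odd d -> msize f = d.+1 ->
  quasiconvex (row_function f) <->
  (forall i j m m',
     (f^`M(i))@_m * (f^`M(j))@_m' = (f^`M(j))@_m * (f^`M(i))@_m') /\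
  (forall i, (forall t, 0 <= (axis_derivative f i).[t]) \/
             (forall t, 0 <= (- axis_derivative f i).[t])).
Proof.
move=> odd_d szf; split=> [qc|[par sgn]].
  split; first by apply: mcoeff_parallel; exact: gradients_parallel odd_d szf qc.
  move=> i; have ss x y : 0 <= (f^`M(i)).@[x] * (f^`M(i)).@[y].
    have sE z : slope f z (unit_vector i) = (f^`M(i)).@[z].
      rewrite /slope (bigD1 i) //= /unit_vector eqxx mul1r big1 ?addr0 //.
      by move=> j /negPf ->; rewrite mul0r.
    by rewrite -!sE; exact: slopes_same_sign odd_d szf qc _ _ _.
  have [[x fx]|no] := pselect (exists x, (f^`M(i)).@[x] < 0).
    right=> t; rewrite hornerN horner_line oppr_ge0.
    by have := ss x (fun j => 0 + t * unit_vector i j); rewrite nmulr_rge0.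
  left=> t; rewrite horner_line leNgt; apply/negP => ft.
  by apply: no; exists (fun j => 0 + t * unit_vector i j).
apply/quasiconvex_segments => x v t t01.
apply: monotone_poly_segment t01.
have [[i [m0 nz]]|zero] := pselect (exists i m0, (f^`M(i))@_m0 != 0); last first.
  left=> s; rewrite deriv_line big1 ?horner0 // => j _.
  have -> : f^`M(j) = 0.
    apply/mpolyP => m; rewrite mcoeff0; apply/eqP; apply: contrapT => /negP nz.
    by apply: zero; exists j, m.
  by rewrite -mpolyC0 lineC polyC0 scaler0.
pose xi j := (f^`M(j))@_m0 / (f^`M(i))@_m0.
have xi1 : xi i = 1 by rewrite /xi divff.
have grad j : f^`M(j) = xi j *: f^`M(i).
  apply/mpolyP => m; rewrite mcoeffZ /xi mulrAC.
  by rewrite -(par i j m0 m) mulrAC divff // mul1r.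
have grad2 j : f^`M(i)^`M(j) = xi j *: f^`M(i)^`M(i).
  by rewrite mderiv_comm grad mderivZ.
have sE s : (line f x v)^`().[s] =
    (\sum_j v j * xi j) * (axis_derivative f i).[\sum_j xi j * (x j + s * v j)].
  rewrite deriv_line_slope /slope -(proportional_gradient xi1 grad2) mulr_suml.
  by apply: eq_bigr => j _; rewrite grad mevalZ mulrA.
set c := \sum_j _ in sE.
have [c0|c0] := lerP 0 c; case: (sgn i) => pos.
- by left=> s; rewrite sE mulr_ge0.
- by right=> s; rewrite sE mulr_ge0_le0 // -oppr_ge0 -hornerN.
- by right=> s; rewrite sE nmulr_rle0.
- by left=> s; rewrite sE nmulr_rge0 // -oppr_ge0 -hornerN.
Qed.

End Criterion.

Section AxisCoefficients.
Context {R : realFieldType} {n : nat}.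

(** On an axis only the powers of its variable survive. *)
Lemma line_axis_monomial (m : 'X_{1..n}) (i : 'I_n) (k : nat) :
  (line 'X_[R, m] (fun=> 0) (fun j => (j == i)%:R))`_k =
  (m == (U_(i) *+ k)%MM)%:R.
Proof.
rewrite /line mmapX /mmap1.
have unitE j : ((U_(i) *+ k)%MM : 'X_{1..n}) j = ((i == j) * k)%N.
  by rewrite mulmnE mnm1E.
have [mi|/existsP[j]] := boolP [forall j, (j != i) ==> (m j == 0%N)].
  rewrite (bigD1 i) //= eqxx scale1r polyC0 add0r big1 => [|j ne_j]; last first.
    by have /forallP/(_ j) := mi; rewrite ne_j /= => /eqP ->; rewrite expr0.
  rewrite mulr1 coefXn; congr (nat_of_bool _)%:R.
  apply/eqP/eqP => [->|->]; last by rewrite unitE eqxx mul1n.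
  apply/mnmP => j; rewrite mulmnE mnm1E; case: eqP => [<-|/eqP ne_j].
    by rewrite mul1n.
  by have /forallP/(_ j) := mi; rewrite eq_sym ne_j => /eqP.
rewrite negb_imply => /andP[ne_ji m_j].
have {j ne_ji m_j} [j ne_j mj] : exists2 j' : 'I_n, j' != i & m j' != 0%N.
  by exists j.
have h0 : ((0 : R)%:P + (j == i)%:R *: 'X) ^+ m j = 0.
  by rewrite (negPf ne_j) scale0r addr0 polyC0 expr0n (negPf mj).
rewrite (bigD1 j) //= h0 mul0r coef0; case: eqP => // em.
by move: mj; rewrite em unitE [i == j]eq_sym (negPf ne_j).
Qed.

Lemma coef_line_axis (g : {mpoly R[n]}) (i : 'I_n) (k : nat) :
  (line g (fun=> 0) (fun j => (j == i)%:R))`_k = g@_(U_(i) *+ k)%MM.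
Proof.
rewrite {1}[g]mpolyE line_sum coef_sum [RHS](congr1 _ (mpolyE g)) raddf_sum /=.
apply: eq_bigr => m _.
by rewrite lineZ coefZ line_axis_monomial mcoeffZ mcoeffX.
Qed.

End AxisCoefficients.

(** * The decision procedure *)

(** The polynomial is kept as an association list from exponents to
    coefficients. *)
Notation table := (seq (seq nat * fraction)).

Definition no_entry : seq nat * fraction := ([::], ([::], [::], ([::], [::]))).

Definition lookup (al : table) (m : seq nat) : fraction :=
  (head no_entry (filter (fun x : seq nat * fraction => x.1 == m) al)).2.

Definition increment_step (s : nat * seq nat) (x : nat) :=
  (s.1.-1, (if s.1 == 1%N then x.+1 else x) :: s.2).

Definition increment (m : seq nat) (j : nat) : seq nat :=
  rev (foldl increment_step (j.+1, [::]) m).2.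

Lemma increment_spec m j : (j < size m)%N -> increment m j = incr_nth m j.
Proof.
rewrite /increment.
have h0 s r : rev (foldl increment_step (0%N, r) s).2 = rev r ++ s.
  by elim: s r => [|x s IH] r /=; rewrite ?cats0 // IH rev_cons cat_rcons.
suff h r : (j < size m)%N ->
    rev (foldl increment_step (j.+1, r) m).2 = rev r ++ incr_nth m j.
  exact: h.
elim: m j r => // x m IH [|j] r /=; first by rewrite h0 rev_cons cat_rcons.
by rewrite ltnS => /IH ->; rewrite rev_cons cat_rcons.
Qed.

(** The coefficient of the monomial [m] in the [j]-th partial derivative. *)
Definition jacobian_entry (al : table) (j : nat) (m : seq nat) : rat :=
  (nth 0%N m j).+1%:R * frac_val (lookup al (increment m j)).

Section Polytime.
Context {E : Type} {eE : encoding E}.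

Lemma polytime_lookup (f : E -> table) (g : E -> seq nat) :
  polytime f -> polytime g -> polytime (fun e => lookup (f e) (g e)).
Proof.
move=> pf pg; apply: polytime_snd_of; apply: polytime_head_of.
apply: (polytime_filter no_entry
  (f := fun e (x : seq nat * fraction) => x.1 == g e)) => //.
apply: polytime_eqseq; first by polytime.
exact: polytime_comp polytime_fst pg.
Qed.

Lemma polytime_increment (f : E -> seq nat) (g : E -> nat) :
  polytime f -> polytime g -> polytime (fun e => increment (f e) (g e)).
Proof.
move=> pf pg; apply: (polytime_rev 0%N); apply: polytime_snd_of.
apply: (polytime_foldl_grow (f := fun _ : E => increment_step) 0%N
  (G := fun n => (2 * n + 10)%N)) => //.
- rewrite /increment_step; apply: polytime_pair; first by polytime.
  apply: polytime_cons; last by polytime.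
  by apply: polytime_if; [apply: polytime_eqn; polytime | polytime | polytime].
- by polytime.
- by poly_bound.
- move=> e [k s] x; rewrite /increment_step !bits_of_pair bits_of_cons /=.
  by rewrite !bits_of_nat; case: ifP => _; lia.
Qed.

Lemma polytime_rat_nat (f : E -> nat) :
  polytime f -> polytime_rat (fun e => (f e)%:R).
Proof.
move=> pf; pose unary n := foldl (fun a (_ : unit) => add_nat a [:: true]) [::]
  (nseq n tt).
have unaryS n : unary n.+1 = add_nat (unary n) [:: true].
  by rewrite /unary -addn1 nseqD foldl_cat.
have pu : polytime (fun e => unary (f e)).
  have [pr [w [pw cf]]] := pf.
  apply: (polytime_foldl (f := fun (_ : E) a (_ : unit) => add_nat a [:: true]) tt
    (Q := fun n => (4 * (2 * w n) + 1)%N)) => //.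
  - by polytime.
  - by polytime.
  - by apply: polytime_nseq.
  - by poly_bound.
  - move=> e i; rewrite size_nseq => le_i; have [le_w _] := cf e.
    rewrite take_nseq // -/(unary i).
    have sz : size (unary i) = (2 * i)%N.
      by elim: i {le_i} => // i IH; rewrite unaryS size_add_nat IH /=; lia.
    have /andP[_ le_b] := bits_of_natural (unary i).
    by rewrite bits_of_nat in le_w; rewrite sz in le_b; lia.
exists (fun e => ((unary (f e), [::]), ([:: true], [::]))); first by polytime.
move=> e; rewrite /frac_val /diff_val /= subr0 !subr0 divr1; congr (_%:R).
by elim: (f e) => // n IH; rewrite unaryS add_natP IH addn1.
Qed.

Lemma polytime_jacobian_entry (f : E -> table) (g : E -> nat) (h : E -> seq nat) :
  polytime f -> polytime g -> polytime h ->
  polytime_rat (fun e => jacobian_entry (f e) (g e) (h e)).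
Proof.
move=> pf pg ph; apply: polytime_rat_mul.
  by apply: polytime_rat_nat; polytime.
exists (fun e => lookup (f e) (increment (h e) (g e))) => //.
by apply: polytime_lookup => //; apply: polytime_increment.
Qed.

End Polytime.

Definition rank_test (al : table) (n : nat) : bool :=
  let ms := [seq x.1 | x <- al] in
  all (fun i => all (fun j => all (fun m => all (fun m' =>
    jacobian_entry al i m * jacobian_entry al j m' ==
    jacobian_entry al j m * jacobian_entry al i m') ms) ms)
    (iota 0 n)) (iota 0 n).

Lemma polytime_rank_test E (eE : encoding E) (f : E -> table) (g : E -> nat) :
  polytime f -> polytime g -> polytime (fun e => rank_test (f e) (g e)).
Proof.
move=> pf pg; refine (polytime_comp (f := fun e => (f e, g e))
  (g := fun x => rank_test x.1 x.2) _ _); first by polytime.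
rewrite /rank_test.
have pms E' (eE' : encoding E') (h : E' -> table) : polytime h ->
    polytime (fun e => [seq x.1 | x <- h e]).
  apply: (polytime_map (f := fun _ x => x.1)
    no_entry [::]).
  by polytime.
apply: (polytime_all 0%N (f := fun x i => _)); last by polytime.
apply: (polytime_all 0%N (f := fun x j => _)); last by polytime.
apply: (polytime_all [::] (f := fun x m => _)); last by apply: pms; polytime.
apply: (polytime_all [::] (f := fun x m => _)); last by apply: pms; polytime.
by apply: polytime_rat_eq; apply: polytime_rat_mul;
   apply: polytime_jacobian_entry; polytime.
Qed.

(** With [m0] the zero exponent, the [i]-th partial derivative on the [i]-th
    axis: only the coefficients of the powers of one variable are looked up. *)
Definition axis_poly (d : nat) (al : table) (i : nat) (m0 : seq nat) :
    {poly rat} :=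
  \poly_(k < d)
    (k.+1%:R * frac_val (lookup al (iter k.+1 (increment^~ i) m0))).

Lemma polytime_axis_poly E (eE : encoding E) d (f : E -> table) (g : E -> nat)
    (h : E -> seq nat) :
  polytime f -> polytime g -> polytime h ->
  polytime_poly d (fun e => axis_poly d (f e) (g e) (h e)).
Proof.
move=> pf pg ph; split=> [e|k]; first exact: size_poly.
have pit l : polytime (fun e => iter l (increment^~ (g e)) (h e)).
  by elim: l => [|l IH] //=; apply: polytime_increment.
apply: (polytime_rat_ext (g := fun e => if (k < d)%N then
    k.+1%:R * frac_val (lookup (f e) (iter k.+1 (increment^~ (g e)) (h e))) else 0)).
  by move=> e; rewrite coef_poly.
case: (k < d)%N; last exact: polytime_rat_const.
apply: polytime_rat_mul; first exact: polytime_rat_const.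
exists (fun e => lookup (f e) (iter k.+1 (increment^~ (g e)) (h e))) => //.
exact: polytime_lookup.
Qed.

Section Correctness.
Variables (R : realType) (d : nat).
Hypothesis odd_d : odd d.

Lemma sign_test_exists : exists2 b : table * nat * seq nat -> bool, polytime b &
  forall al i m0, b (al, i, m0) <->
    (forall t : R, 0 <= (map_poly ratr (axis_poly d al i m0)).[t]) \/
    (forall t : R, 0 <= (- map_poly ratr (axis_poly d al i m0)).[t]).
Proof.
have pax : polytime_poly d (fun e : table * nat * seq nat =>
    axis_poly d e.1.1 e.1.2 e.2) by apply: polytime_axis_poly; polytime.
have [b pb hb] := polytime_nonnegative R pax.
have [b' pb' hb'] := polytime_nonnegative R (polytime_poly_opp pax).
exists (fun e => b e || b' e); first by polytime.
move=> al i m0; have := hb (al, i, m0); have := hb' (al, i, m0).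
rewrite /= rmorphN /= => h' h.
by split=> [/orP[/h|/h']|[/h ->|/h' ->]]; [left|right| |rewrite orbT].
Qed.

Section Instance.
Variable p : ratpoly d.
Let n := nvars p.
Let f := poly_of p.
Let F : {mpoly R[n]} := map_mpoly ratr f.

Lemma msize_poly_of : msize f = d.+1.
Proof. by rewrite /f; case: p. Qed.

Lemma msize_real : msize F = d.+1.
Proof.
rewrite -msize_poly_of !msizeE; apply: perm_big.
exact/msupp_map_mpoly/fmorph_inj.
Qed.

Lemma coef_large (m : 'X_{1..n}) : (d < mdeg m)%N -> f@_m = 0.
Proof.
by move=> lt_m; apply/memN_msupp_eq0/msize_mdeg_ge; rewrite msize_poly_of.
Qed.

Let L := exponents_upto n d.
Let al : table := [seq (s, frac_of f@_(to_mnm n s)) | s <- L].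

Lemma parse_instance :
  parse (encode_ratpoly p) = [seq frac_of f@_(to_mnm n s) | s <- L].
Proof.
rewrite /encode_ratpoly -/n -/f monomialsE -map_comp.
rewrite -[LHS]/(parse (flatten [seq encode_rat f@_(to_mnm n s) | s <- L])).
by rewrite (map_comp encode_rat (fun s => f@_(to_mnm n s))) parse_encode -map_comp.
Qed.

Lemma enumerate_instance : enumerate d (parse (encode_ratpoly p)) = L.
Proof.
apply: enumerateE; first by rewrite odd_gt0.
by rewrite parse_instance size_map.
Qed.

Lemma lookup_instance s : size s = n -> frac_val (lookup al s) = f@_(to_mnm n s).
Proof.
move=> szs; rewrite /lookup /al filter_map.
have [sL|sL] := boolP (s \in L).
  rewrite (eq_filter (a2 := pred1 s)) // filter_pred1_uniq //=.
    exact: frac_ofP.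
  exact: uniq_exponents_upto.
rewrite (eq_in_filter (a2 := pred0)) => [|t tL]; last first.
  by apply/negbTE; apply: contraNneq sL => <-.
rewrite filter_pred0 /= /frac_val /diff_val /= !subrr mul0r coef_large //.
rewrite mdeg_to_mnm // ltnNge; apply: contra sL => le_d.
by rewrite mem_exponents_upto szs eqxx.
Qed.

Lemma to_mnm_incr s (i : 'I_n) : size s = n ->
  to_mnm n (incr_nth s i) = (to_mnm n s + U_(i))%MM.
Proof.
by move=> szs; apply/mnmP => j; rewrite mnmDE mnm1E !mnmE nth_incr_nth addnC.
Qed.

Lemma size_increment s (i : 'I_n) : size s = n -> size (increment s i) = n.
Proof. by move=> szs; rewrite increment_spec ?size_incr_nth szs ltn_ord. Qed.

Lemma jacobian_entryE s (i : 'I_n) : size s = n ->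
  jacobian_entry al i s = (f^`M(i))@_(to_mnm n s).
Proof.
move=> szs; rewrite /jacobian_entry lookup_instance ?size_increment //.
rewrite increment_spec ?szs // to_mnm_incr // mcoeff_mderiv mulr_natl.
by rewrite mnmE.
Qed.

Lemma rank_testP : rank_test al n <->
  forall i j m m',
    (F^`M(i))@_m * (F^`M(j))@_m' = (F^`M(j))@_m * (F^`M(i))@_m'.
Proof.
have derivF i m : (F^`M(i))@_m = ratr (f^`M(i))@_m.
  by rewrite !mcoeff_mderiv mcoeff_map_mpoly rmorphMn.
have eL : [seq x.1 | x <- al] = L by rewrite -map_comp map_id.
have szL s : s \in L -> size s = n.
  by rewrite mem_exponents_upto => /andP[/eqP].
rewrite /rank_test eL; split=> [test i j m m'|par].
  rewrite !derivF -!rmorphM; congr ratr.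
  have large (k : 'I_n) (m1 : 'X_{1..n}) : (m1 : seq nat) \notin L ->
      (f^`M(k))@_m1 = 0.
    rewrite mem_exponents_upto size_tuple eqxx /= -ltnNge => lt_d.
    rewrite mcoeff_mderiv coef_large ?mul0rn // mdegD mdeg1 addn1 ltnS ltnW //.
    by rewrite -(to_of_mnm m1) mdeg_to_mnm ?size_tuple.
  have [mL|/large mL] := boolP ((m : seq nat) \in L); last by rewrite !mL !mul0r.
  have [m'L|/large m'L] := boolP ((m' : seq nat) \in L); last first.
    by rewrite !m'L !mulr0.
  have inI (k : 'I_n) : (k : nat) \in iota 0 n by rewrite mem_iota ltn_ord.
  have /allP/(_ _ (inI i))/allP/(_ _ (inI j))/allP/(_ _ mL)/allP/(_ _ m'L) := test.
  by rewrite !jacobian_entryE ?size_tuple // !to_of_mnm => /eqP.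
apply/allP => i; rewrite mem_iota => /andP[_ lt_i].
apply/allP => j; rewrite mem_iota => /andP[_ lt_j].
apply/allP => m mL; apply/allP => m' m'L.
rewrite -[i]/(nat_of_ord (Ordinal lt_i)) -[j]/(nat_of_ord (Ordinal lt_j)).
rewrite !jacobian_entryE ?szL //; apply/eqP.
apply: (fmorph_inj (ratr : {rmorphism rat -> R})).
by rewrite !rmorphM /= -!derivF par.
Qed.

Lemma head_exponents_upto n' d' : head [::] (exponents_upto n' d') = nseq n' 0%N.
Proof.
suff h : exponents n' 0 = [:: nseq n' 0%N].
  by rewrite /exponents_upto /= h.
by elim: n' => //= n' IH; rewrite /exponents_step /= IH.
Qed.

Lemma axis_polyE (i : 'I_n) :
  map_poly ratr (axis_poly d al i (nseq n 0%N)) = axis_derivative F i.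
Proof.
apply/polyP => k; rewrite coef_map coef_line_axis mcoeff_mderiv.
rewrite mcoeff_map_mpoly -rmorphMn; congr ratr.
have -> : (U_(i) *+ k + U_(i))%MM = (U_(i) *+ k.+1)%MM by rewrite mulmSr.
rewrite mulmnE mnm1E eqxx mul1n coef_poly.
case: ltnP => [_|le_d]; last first.
  by rewrite coef_large ?mul0rn // mdegMn mdeg1 mul1n ltnS.
have iterE l : size (iter l (increment^~ i) (nseq n 0%N)) = n /\
    to_mnm n (iter l (increment^~ i) (nseq n 0%N)) = (U_(i) *+ l)%MM.
  elim: l => [|l [szl el]] /=.
    rewrite size_nseq; split=> //; apply/mnmP => j.
    by rewrite mulm0n mnm0E mnmE nth_nseq if_same.
  split; first exact: size_increment.
  by rewrite increment_spec ?szl // to_mnm_incr // el -mulmSr.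
have [szi ei] := iterE k.+1.
by rewrite lookup_instance // ei mulr_natl.
Qed.

End Instance.

(** Only the parsed list is available to the procedure: the exponents and the
    number of variables come from the enumeration, whose first element is the
    zero exponent. *)
Lemma decision_exists : exists2 decide : seq bool -> bool, polytime decide &
  forall p : ratpoly d,
    decide (encode_ratpoly p) <-> quasiconvex (@real_function R d p).
Proof.
have [b pb hb] := sign_test_exists.
pose entries w : table := zip (enumerate d (parse w)) (parse w).
pose zero w : seq nat := head [::] (enumerate d (parse w)).
have ppar : polytime (fun w => parse w) by exact: polytime_parse.
have penum : polytime (fun w => enumerate d (parse w)).
  exact: polytime_comp ppar (polytime_enumerate _ no_entry.2 d).
have pent : polytime entries by exact: (polytime_zip [::] no_entry.2).
have pz : polytime zero by exact: polytime_head_of.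
have psz : polytime (fun w => size (zero w)) by exact: (polytime_size 0%N).
exists (fun w => rank_test (entries w) (size (zero w)) &&
    all (fun i => b (entries w, i, zero w)) (iota 0 (size (zero w)))).
  apply: polytime_and; first exact: polytime_rank_test.
  apply: (polytime_all 0%N (f := fun w i => b (entries w, i, zero w)));
    last by polytime.
  refine (polytime_comp (f := fun x : seq bool * nat =>
    (entries x.1, x.2, zero x.1)) _ pb).
  apply: polytime_pair; last exact: polytime_comp polytime_fst pz.
  apply: polytime_pair; last by polytime.
  exact: polytime_comp polytime_fst pent.
move=> p; pose n := nvars p.
have entE : entries (encode_ratpoly p) =
    [seq (s, frac_of (poly_of p)@_(to_mnm n s)) | s <- exponents_upto n d].
  rewrite /entries enumerate_instance parse_instance.
  by elim: (exponents_upto _ _) => //= s l ->.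
have zeroE : zero (encode_ratpoly p) = nseq n 0%N.
  by rewrite /zero enumerate_instance head_exponents_upto.
rewrite entE zeroE size_nseq.
have crit := quasiconvex_criterion odd_d (msize_real p).
split=> [/andP[/rank_testP par /allP sgn]|/crit[par sgn]].
  apply/crit; split=> // i; rewrite -axis_polyE; apply/hb.
  by apply: sgn; rewrite mem_iota ltn_ord.
apply/andP; split; first exact/rank_testP.
apply/allP => i; rewrite mem_iota => /andP[_ lt_i].
apply/hb; rewrite -[i]/(nat_of_ord (Ordinal lt_i)) axis_polyE.
exact: sgn.
Qed.

End Correctness.

Theorem theorem2p21 (R : realType) (d : nat) (hd : odd d) :
  @polytime_decidable (ratpoly d) (@encode_ratpoly d)
    (fun p : ratpoly d => @quasiconvex R (nvars p) (@real_function R d p)).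
Proof.
have [decide pdecide hdecide] := decision_exists R hd.
exact: polytime_decides pdecide hdecide.
Qed.
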